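(* Let $\mathcal{C}$ be a root class of groups consisting only of periodic groups, and let $G^{*} = \langle G, t;\ t^{-1}Ht = K,\ \varphi \rangle$ be the HNN-extension of a group $G$ with subgroups $H$ and $K$ associated by an isomorphism $\varphi\colon H \to K$, where $H \ne G \ne K$. Suppose that $H$ and $K$ are infinite cyclic subgroups lying in the center of $G$. Suppose also that $G$ is residually a $\mathcal{C}\mbox{-}\mathcal{BN}_{\mathfrak{P}(\mathcal{C})}$-group and has a homomorphism onto a $\mathcal{C}\mbox{-}\mathcal{BN}_{\mathfrak{P}(\mathcal{C})}$-group that acts injectively on $HK$. Then $G^{*}$ is residually a $\mathcal{C}$-group if and only if all of the following hold: 1) $H/(H \cap K)$ and $K/(H \cap K)$ are of the same order; 2) $H$ and $K$ are $\mathfrak{P}(\mathcal{C})'$-isolated in $G$; 3) $2 \in \mathfrak{P}(\mathcal{C})$, unless $H \cap K$ lies in the center of $G^{*}$.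
   Context: As usual, classes of groups are closed under isomorphism. A class of groups $\mathcal{C}$ is called a root class if it contains at least one non-trivial group and is closed under taking subgroups, extensions, and Cartesian (i.e. unrestricted direct) products of the form $\prod_{y \in Y} X_{y}$, where $X, Y \in \mathcal{C}$ and $X_{y}$ is an isomorphic copy of $X$ for each $y \in Y$. For any class of groups $\mathcal{D}$, a group $X$ is residually a $\mathcal{D}$-group if for any $x \in X \setminus \{1\}$ there exists a homomorphism $\sigma$ of $X$ onto a group from $\mathcal{D}$ such that $x\sigma \ne 1$. For a class of periodic groups $\mathcal{C}$, $\mathfrak{P}(\mathcal{C})$ denotes the set of all primes each of which divides the order of an element of some $\mathcal{C}$-group, and $\mathfrak{P}(\mathcal{C})'$ is the set of all primes not in $\mathfrak{P}(\mathcal{C})$. A subgroup $Y$ of a group $X$ is $\mathfrak{P}(\mathcal{C})'$-isolated in $X$ if, for any $x \in X$ and $q \in \mathfrak{P}(\mathcal{C})'$, $x^{q} \in Y$ implies $x \in Y$. A group is $\mathfrak{P}(\mathcal{C})'$-torsion-free if its trivial subgroup is $\mathfrak{P}(\mathcal{C})'$-isolated. For an abelian group $A$ and $p \in \mathfrak{P}(\mathcal{C})$, the subgroup of all elements of $p$-power order of $A$ is called a primary $\mathfrak{P}(\mathcal{C})$-component of $A$. An abelian group $A$ is $\mathcal{C}$-bounded if, for any quotient group $B$ of $A$, each primary $\mathfrak{P}(\mathcal{C})$-component of $B$ has a finite exponent and a cardinality not exceeding the cardinality of some $\mathcal{C}$-group. A nilpotent group is $\mathcal{C}$-bounded if it has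 at least one finite central series with $\mathcal{C}$-bounded abelian factors. $\mathcal{C}\mbox{-}\mathcal{BN}_{\mathfrak{P}(\mathcal{C})}$ denotes the class of all $\mathfrak{P}(\mathcal{C})'$-torsion-free $\mathcal{C}$-bounded nilpotent groups. A homomorphism acts injectively on a subgroup if its restriction to that subgroup is injective. Maps are written on the right; in $G^{*}$, $t^{-1}ht = h\varphi$ for all $h \in H$. *)

(* Defs.v *)
From HB Require Import structures.
From mathcomp Require Import all_boot all_classical.

Set Implicit Arguments.
Unset Strict Implicit.
Unset Printing Implicit Defensive.

Local Open Scope classical_set_scope.
Local Open Scope group_scope.
Local Open Scope quotient_scope.

(* Groups are (possibly infinite) [groupType]s; the choice
   structure they carry is no restriction, classically. Subgroups of [G] are
   [groupClosed G]: predicates on [G] closed under the group operations. *)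

Definition surjective_map (X Y : Type) (f : X -> Y) := forall y, exists x, f x = y.

Definition isomorphic (X Y : groupType) :=
  exists f : {multiplicative X -> Y}, bijective f.

Definition central (G : groupType) (x : G) := forall y : G, commute x y.

Definition normal (G : groupType) (N : {pred G}) :=
  forall x g : G, x \in N -> x ^ g \in N.

Section Subg.
Variables (G : groupType) (H : groupClosed G).

Record subg : Type := Subg { subg_val :> G; _ : subg_val \in H }.

HB.instance Definition _ := [isSub for subg_val].
HB.instance Definition _ := [Choice of subg by <:].

Lemma subg_closed : group_closed (fun x : G => x \in H).
Proof. by split; [exact: gpred1 | move=> x y; exact: gpredF]. Qed.

HB.instance Definition _ :=
  SubChoice_isSubGroup.Build G (fun x : G => x \in H) subg subg_closed.
End Subg.

(* [N] viewed inside the group [subg A]; it is [N] itself when [N <= A]. *)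
Definition subg_pred (G : groupType) (A N : groupClosed G) : {pred subg A} :=
  [pred x : subg A | val x \in N].
Arguments subg_pred {G} A N.

Section SubgPred.
Variables (G : groupType) (A N : groupClosed G).

Lemma subg_predM : mulg_closed (subg_pred A N).
Proof. by move=> x y /= Nx Ny; rewrite inE valM; exact: gpredM. Qed.

Lemma subg_pred1 : 1 \in subg_pred A N.
Proof. by rewrite inE val1 gpred1. Qed.

Lemma subg_predV : invg_closed (subg_pred A N).
Proof. by move=> x /= Nx; rewrite inE gmulfV gpredV. Qed.

HB.instance Definition _ :=
  isMulClosed.Build (subg A) (subg_pred A N) subg_predM.
HB.instance Definition _ :=
  isMul1Closed.Build (subg A) (subg_pred A N) subg_pred1.
HB.instance Definition _ :=
  isInvClosed.Build (subg A) (subg_pred A N) subg_predV.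
End SubgPred.

Section Quotient.
Variables (G : groupType) (N : groupClosed G).

Definition coset_rel (x y : G) : bool := x^-1 * y \in N.

Lemma coset_rel_refl : reflexive coset_rel.
Proof. by move=> x; rewrite /coset_rel mulVg gpred1. Qed.

Lemma coset_rel_sym : symmetric coset_rel.
Proof. by move=> x y; rewrite /coset_rel -gpredV invgM invgK. Qed.

Lemma coset_rel_trans : transitive coset_rel.
Proof.
move=> y x z xy yz; rewrite /coset_rel -(mulVKg y z) mulgA; exact: gpredM.
Qed.

Canonical coset_equiv := EquivRel coset_rel
  coset_rel_refl coset_rel_sym coset_rel_trans.

Definition quotg (nN : normal N) : Type := {eq_quot coset_equiv}.

Variable nN : normal N.
HB.instance Definition _ := Choice.on (quotg nN).

Definition quotg_proj (x : G) : quotg nN := \pi_({eq_quot coset_equiv}) x.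
Definition quotg_repr (x : quotg nN) : G := repr (x : {eq_quot coset_equiv}).

Lemma quotg_projP x y : quotg_proj x = quotg_proj y <-> x^-1 * y \in N.
Proof. by split=> [/eqmodP|h]; last exact/eqmodP. Qed.

Lemma quotg_reprK x : quotg_proj (quotg_repr x) = x.
Proof. exact: reprK. Qed.

Definition quotg_mul x y := quotg_proj (quotg_repr x * quotg_repr y).
Definition quotg_inv x := quotg_proj (quotg_repr x)^-1.

Lemma quotg_projM x y :
  quotg_mul (quotg_proj x) (quotg_proj y) = quotg_proj (x * y).
Proof.
apply/quotg_projP.
have /quotg_projP := quotg_reprK (quotg_proj x).
have /quotg_projP := quotg_reprK (quotg_proj y).
move: (quotg_repr _) (quotg_repr _) => y' x' hy hx.
have -> : (y' * x')^-1 * (x * y) = (y'^-1 * x) ^ x' * (x'^-1 * y).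
  by rewrite conjgE invgM !mulgA mulgK.
by apply: gpredM => //; exact: nN.
Qed.

Lemma quotg_projV x : quotg_inv (quotg_proj x) = quotg_proj x^-1.
Proof.
apply/quotg_projP.
have /quotg_projP := quotg_reprK (quotg_proj x).
move: (quotg_repr _) => x' hx.
rewrite invgK -gpredV invgM invgK.
have -> : x * x'^-1 = (x'^-1 * x) ^ x'^-1.
  by rewrite conjgE invgK !mulgA mulgV mul1g.
exact: nN.
Qed.

Lemma quotg_mulA : associative quotg_mul.
Proof.
move=> x y z; rewrite -(quotg_reprK x) -(quotg_reprK y) -(quotg_reprK z).
by rewrite !quotg_projM mulgA.
Qed.

Lemma quotg_mul1 : left_id (quotg_proj 1) quotg_mul.
Proof. by move=> x; rewrite -(quotg_reprK x) quotg_projM mul1g. Qed.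

Lemma quotg_mulr1 : right_id (quotg_proj 1) quotg_mul.
Proof. by move=> x; rewrite -(quotg_reprK x) quotg_projM mulg1. Qed.

Lemma quotg_mulV : left_inverse (quotg_proj 1) quotg_inv quotg_mul.
Proof.
by move=> x; rewrite -(quotg_reprK x) quotg_projV quotg_projM mulVg.
Qed.

Lemma quotg_mulrV : right_inverse (quotg_proj 1) quotg_inv quotg_mul.
Proof.
by move=> x; rewrite -(quotg_reprK x) quotg_projV quotg_projM mulgV.
Qed.

HB.instance Definition _ := isGroup.Build (quotg nN)
  quotg_mulA quotg_mul1 quotg_mulr1 quotg_mulV quotg_mulrV.

Lemma quotg_proj_morph : {morph quotg_proj : x y / x * y}.
Proof. by move=> x y; rewrite -quotg_projM. Qed.

HB.instance Definition _ :=
  isMultiplicative.Build G (quotg nN) quotg_proj quotg_proj_morph.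
End Quotient.

Definition cartesian (Y : Type) (X : Y -> groupType) : Type := forall y, X y.

Section Cartesian.
Variables (Y : Type) (X : Y -> groupType).
Local Notation P := (cartesian X).

HB.instance Definition _ := Choice.copy P (forall y, X y).

Definition cart_one : P := fun y => 1.
Definition cart_mul (f g : P) : P := fun y => f y * g y.
Definition cart_inv (f : P) : P := fun y => (f y)^-1.

Lemma cart_mulA : associative cart_mul.
Proof. by move=> f g h; apply: functional_extensionality_dep => y; exact: mulgA. Qed.

Lemma cart_mul1 : left_id cart_one cart_mul.
Proof. by move=> f; apply: functional_extensionality_dep => y; exact: mul1g. Qed.

Lemma cart_mulr1 : right_id cart_one cart_mul.
Proof. by move=> f; apply: functional_extensionality_dep => y; exact: mulg1. Qed.

Lemma cart_mulV : left_inverse cart_one cart_inv cart_mul.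
Proof. by move=> f; apply: functional_extensionality_dep => y; exact: mulVg. Qed.

Lemma cart_mulrV : right_inverse cart_one cart_inv cart_mul.
Proof. by move=> f; apply: functional_extensionality_dep => y; exact: mulgV. Qed.

HB.instance Definition _ := isGroup.Build (cartesian X)
  cart_mulA cart_mul1 cart_mulr1 cart_mulV cart_mulrV.
End Cartesian.

Definition group_class := groupType -> Prop.

Definition iso_closed (C : group_class) :=
  forall X Y : groupType, isomorphic X Y -> C X -> C Y.

Definition root_class (C : group_class) :=
  [/\ iso_closed C,
      exists X : groupType, C X /\ exists x : X, x <> 1,
      forall (X : groupType) (H : groupClosed X), C X -> C (subg H),
      forall (X : groupType) (N : groupClosed X) (nN : normal N),
        C (subg N) -> C (quotg nN) -> C X
    & forall (X Y : groupType) (F : Y -> groupType), C X -> C Y ->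
        (forall y, isomorphic X (F y)) -> C (cartesian F)].

Definition periodic (X : groupType) :=
  forall x : X, exists2 n : nat, (0 < n)%N & x ^+ n = 1.

Definition residually (D : group_class) (X : groupType) :=
  forall x : X, x <> 1 ->
  exists (Y : groupType) (f : {multiplicative X -> Y}),
    [/\ D Y, surjective_map f & f x <> 1].

Definition has_order (X : groupType) (x : X) (n : nat) :=
  [/\ (0 < n)%N, x ^+ n = 1 & forall m, (0 < m)%N -> x ^+ m = 1 -> (n <= m)%N].

Definition primes_of (C : group_class) : set nat :=
  [set p | prime p /\ exists (X : groupType) (x : X) (n : nat),
     [/\ C X, has_order x n & (p %| n)%N]].

Definition primes_of' (C : group_class) : set nat :=
  [set q | prime q /\ ~ primes_of C q].

Definition isolated (P : set nat) (X : groupType) (Y : {pred X}) :=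
  forall (x : X) (q : nat), P q -> x ^+ q \in Y -> x \in Y.

Definition torsion_free (P : set nat) (X : groupType) :=
  isolated P (pred1 (1 : X)).

Definition primary_component (B : groupType) (p : nat) : set B :=
  [set x | exists k : nat, x ^+ (p ^ k)%N = 1].
Arguments primary_component B p : clear implicits.

Definition finite_exponent (B : groupType) (S : set B) :=
  exists2 e : nat, (0 < e)%N & forall x, S x -> x ^+ e = 1.

Definition bounded_abelian (C : group_class) (A : groupType) :=
  (forall x y : A, commute x y) /\
  forall (N : groupClosed A) (nN : normal N) (p : nat), primes_of C p ->
    finite_exponent (primary_component (quotg nN) p) /\
    exists X : groupType,
      C X /\ (primary_component (quotg nN) p #<= [set: X])%card.

(* [1 = Z 0 <= Z 1 <= ... <= Z n = X] with [Z i.+1 / Z i] central in [X / Z i]. *)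
Definition central_series (X : groupType) (n : nat) (Z : nat -> groupClosed X) :=
  [/\ Z 0%N =i pred1 1,
      Z n =i predT,
      forall i, (i < n)%N -> {subset Z i <= Z i.+1}
    & forall i, (i < n)%N -> forall x y : X, x \in Z i.+1 -> [~ x, y] \in Z i].

Definition nilpotent_group (X : groupType) :=
  exists (n : nat) (Z : nat -> groupClosed X), central_series n Z.

(* The existential over the proof [nN] only records that [Z i] is normal in
   [Z i.+1], which holds in any central series. *)
Definition bounded_nilpotent (C : group_class) (X : groupType) :=
  nilpotent_group X /\
  exists (n : nat) (Z : nat -> groupClosed X), central_series n Z /\
    forall i, (i < n)%N ->
      exists nN : normal (subg_pred (Z i.+1) (Z i)), bounded_abelian C (quotg nN).

Definition BN (C : group_class) : group_class :=
  fun X => torsion_free (primes_of' C) X /\ bounded_nilpotent C X.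

Definition cyclic_subgroup (G : groupType) (H : {pred G}) :=
  exists h : G, forall x : G,
    x \in H <-> exists n : nat, x = h ^+ n \/ x = h ^- n.

Definition infinite_cyclic (G : groupType) (H : {pred G}) :=
  cyclic_subgroup H /\ infinite_set [set x | x \in H].

Definition set_mul (G : groupType) (H K : {pred G}) : set G :=
  [set x | exists h k, [/\ h \in H, k \in K & x = h * k]].

(* The set of cosets [H / L]. *)
Definition cosets (G : groupType) (H L : {pred G}) : set (set G) :=
  [set [set h * l | l in [set l | l \in L]] | h in [set h | h \in H]].

(* The HNN-extension, defined by its presentation: group words in the elements
   of [G] and the stable letter, modulo the least congruence containing the
   group axioms, the multiplication table of [G], and [t^-1 h t = h phi]. *)
Inductive hnn_word (G : Type) : Type :=
  | HnnOne
  | HnnMul of hnn_word G & hnn_word G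
  | HnnInv of hnn_word G
  | HnnGen of G
  | HnnT.
Arguments HnnOne {G}.
Arguments HnnT {G}.

HB.instance Definition _ (G : Type) := gen_eqMixin (hnn_word G).
HB.instance Definition _ (G : Type) := gen_choiceMixin (hnn_word G).

Section HNN.
Variables (G : groupType) (H K : groupClosed G).
Variable phi : {multiplicative subg H -> subg K}.
Local Notation word := (hnn_word G).

Inductive hnn_cong : word -> word -> Prop :=
  | hnn_refl u : hnn_cong u u
  | hnn_sym u v : hnn_cong u v -> hnn_cong v u
  | hnn_trans u v w : hnn_cong u v -> hnn_cong v w -> hnn_cong u w
  | hnn_congM u u' v v' : hnn_cong u u' -> hnn_cong v v' ->
      hnn_cong (HnnMul u v) (HnnMul u' v')
  | hnn_congV u u' : hnn_cong u u' -> hnn_cong (HnnInv u) (HnnInv u')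
  | hnn_mulA u v w :
      hnn_cong (HnnMul u (HnnMul v w)) (HnnMul (HnnMul u v) w)
  | hnn_mul1 u : hnn_cong (HnnMul HnnOne u) u
  | hnn_mulr1 u : hnn_cong (HnnMul u HnnOne) u
  | hnn_mulV u : hnn_cong (HnnMul (HnnInv u) u) HnnOne
  | hnn_mulrV u : hnn_cong (HnnMul u (HnnInv u)) HnnOne
  | hnn_gen x y : hnn_cong (HnnGen (x * y)) (HnnMul (HnnGen x) (HnnGen y))
  | hnn_stable (h : subg H) :
      hnn_cong (HnnMul (HnnMul (HnnInv HnnT) (HnnGen (val h))) HnnT)
               (HnnGen (val (phi h))).

Definition hnn_rel (u v : word) : bool := `[< hnn_cong u v >].

Lemma hnn_rel_refl : reflexive hnn_rel.
Proof. by move=> u; apply/asboolP; exact: hnn_refl. Qed.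

Lemma hnn_rel_sym : symmetric hnn_rel.
Proof. by move=> u v; apply/asboolP/asboolP; exact: hnn_sym. Qed.

Lemma hnn_rel_trans : transitive hnn_rel.
Proof.
by move=> v u w /asboolP uv /asboolP vw; apply/asboolP; exact: hnn_trans uv vw.
Qed.

Canonical hnn_equiv := EquivRel hnn_rel hnn_rel_refl hnn_rel_sym hnn_rel_trans.

Definition hnn : Type := {eq_quot hnn_equiv}.
HB.instance Definition _ := Choice.on hnn.

Definition hnn_proj (u : word) : hnn := \pi_({eq_quot hnn_equiv}) u.
Definition hnn_repr (x : hnn) : word := repr (x : {eq_quot hnn_equiv}).

Lemma hnn_projP u v : hnn_proj u = hnn_proj v <-> hnn_cong u v.
Proof. by split=> [/eqmodP/asboolP|h]; last exact/eqmodP/asboolP. Qed.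

Lemma hnn_reprK x : hnn_proj (hnn_repr x) = x.
Proof. exact: reprK. Qed.

Definition hnn_mul x y := hnn_proj (HnnMul (hnn_repr x) (hnn_repr y)).
Definition hnn_inv x := hnn_proj (HnnInv (hnn_repr x)).

Lemma hnn_projM u v : hnn_mul (hnn_proj u) (hnn_proj v) = hnn_proj (HnnMul u v).
Proof. by apply/hnn_projP/hnn_congM; apply/hnn_projP/hnn_reprK. Qed.

Lemma hnn_projV u : hnn_inv (hnn_proj u) = hnn_proj (HnnInv u).
Proof. by apply/hnn_projP/hnn_congV/hnn_projP/hnn_reprK. Qed.

Lemma hnn_grp_mulA : associative hnn_mul.
Proof.
move=> x y z; rewrite -(hnn_reprK x) -(hnn_reprK y) -(hnn_reprK z) !hnn_projM.
exact/hnn_projP/hnn_mulA.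
Qed.

Lemma hnn_grp_mul1 : left_id (hnn_proj HnnOne) hnn_mul.
Proof.
by move=> x; rewrite -(hnn_reprK x) hnn_projM; exact/hnn_projP/hnn_mul1.
Qed.

Lemma hnn_grp_mulr1 : right_id (hnn_proj HnnOne) hnn_mul.
Proof.
by move=> x; rewrite -(hnn_reprK x) hnn_projM; exact/hnn_projP/hnn_mulr1.
Qed.

Lemma hnn_grp_mulV : left_inverse (hnn_proj HnnOne) hnn_inv hnn_mul.
Proof.
move=> x; rewrite -(hnn_reprK x) hnn_projV hnn_projM.
exact/hnn_projP/hnn_mulV.
Qed.

Lemma hnn_grp_mulrV : right_inverse (hnn_proj HnnOne) hnn_inv hnn_mul.
Proof.
move=> x; rewrite -(hnn_reprK x) hnn_projV hnn_projM.
exact/hnn_projP/hnn_mulrV.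
Qed.

HB.instance Definition _ := isGroup.Build hnn
  hnn_grp_mulA hnn_grp_mul1 hnn_grp_mulr1 hnn_grp_mulV hnn_grp_mulrV.

Definition hnn_incl (x : G) : hnn := hnn_proj (HnnGen x).
Definition hnn_t : hnn := hnn_proj HnnT.

Lemma hnn_incl_morph : {morph hnn_incl : x y / x * y}.
Proof.
move=> x y; rewrite -[RHS]/(hnn_mul (hnn_incl x) (hnn_incl y)) hnn_projM.
exact/hnn_projP/hnn_gen.
Qed.

HB.instance Definition _ :=
  isMultiplicative.Build G hnn hnn_incl hnn_incl_morph.

Lemma hnn_stableE (h : subg H) :
  hnn_t^-1 * hnn_incl (val h) * hnn_t = hnn_incl (val (phi h)).
Proof.
rewrite -[LHS]/(hnn_mul (hnn_mul (hnn_inv hnn_t) (hnn_incl (val h))) hnn_t).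
rewrite /hnn_t /hnn_incl hnn_projV !hnn_projM; apply/hnn_projP; exact: hnn_stable.
Qed.
End HNN.

(* Main.v *)
Require Import Defs.
From HB Require Import structures.
From mathcomp Require Import all_boot all_classical.
From mathcomp Require Import ssralg ssrint zify.

Set Implicit Arguments.
Unset Strict Implicit.
Unset Printing Implicit Defensive.

Local Open Scope classical_set_scope.
Local Open Scope group_scope.

(** Write [h] for a generator of [H] and [k] for its image under [phi]; both are
    central in [G], and conjugation by [t] carries [h] to [k]. Let [pi] be the
    set of primes that divide orders of elements of [C]-groups.

    Everything rests on one way of detecting reduced words [reduced_detected].
    Suppose that a homomorphism [rho] from the HNN-extension to a group [B]
    separates the syllables of a reduced word from the associated subgroups
    wherever a pinch could arise. Map [t] to [(f, rho t)] in the unrestricted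
    wreath product of some group [V] by [B], where [f] is constant on the cosets
    of [rho H] and otherwise arbitrary. The first component of the word is then
    a reduced word of the free group on these cosets, evaluated in [V]; and free
    reduced words are detected in iterated wreath products
    [free_word_separated].

    Applied to the class of all groups and to a permutation representation of
    the HNN-extension that is faithful on [G] [hnn_embedding], this yields
    Britton's lemma and with it the necessity of the three conditions. If [x] is
    outside one associated subgroup and [y] outside the other, then some
    conjugate of [x] by [t] or its inverse does not commute with [y], and this
    is visible in a [C]-group. If [x ^ q] is in [H] with [q] outside [pi], then
    in a periodic [C]-group [x] is a power of [x ^ q], whose conjugate is
    central in [G]: a contradiction. If [H] and [K] meet in [<h^m> = <k^n>] with
    [m] different from [n], then in every [C]-group the subgroups generated by
    [h^g] and [k^g], [g = gcd m n], coincide [gcd_power], with the same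
    contradiction. If [h^m = k^(-m)], then [t] inverts [h^m]; where all orders
    are odd, this forces the image of [h^m] to be trivial.

    Conversely let the conditions hold. By the detection lemma it suffices to
    separate one element [g] from [H] (or [K]) in a [C]-quotient of the
    HNN-extension. If no power of [g] with exponent prime to [pi] lies in [HK],
    then a bounded nilpotent image of [G] has a [C]-quotient in which [H] and [K]
    vanish but [g] does not [separating_pquotient], and [t] may be sent to [1].
    Otherwise [g] may be replaced by such a power [h^a k^b]. Now characters of
    [HK] with values in a cyclic [p]-group, indexed by a finite group, are
    extended to a normal subgroup of [G] with quotient in [C] and induced to
    [G]; if a translation of the index set matches the value at [h] with the
    value at [k], it serves as the image of [t] [character_hnn]. Such families
    of characters that distinguish [h^a k^b] from [H] exist in the three cases
    [HK = H x K], [h^m = k^m] and [h^m = k^(-m)]; the equality of the indices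
    leaves no other case, isolation makes every prime divisor of [m] a member of
    [pi], and in the last case the index set needs a group of order two. *)

(** * Homomorphisms, subgroups and integer powers *)

Section Hom.
Variables (X Y : groupType).

Definition hom_fun (f : X -> Y) of {morph f : x y / x * y} : X -> Y := f.
HB.instance Definition _ f (fM : {morph f : x y / x * y}) :=
  isMultiplicative.Build X Y (hom_fun fM) fM.
Definition hom f (fM : {morph f : x y / x * y}) : {multiplicative X -> Y} :=
  hom_fun fM.

Variable f : {multiplicative X -> Y}.

Lemma hom1 : f 1 = 1.
Proof. by apply: (mulgI (f 1)); rewrite -gmulfM !mulg1. Qed.

Lemma homV x : f x^-1 = (f x)^-1.
Proof. by apply/esym/mulg1_eq; rewrite -gmulfM mulgV hom1. Qed.

Lemma homX x n : f (x ^+ n) = f x ^+ n.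
Proof. by elim: n => [|n IHn]; rewrite ?hom1 // !expgS gmulfM IHn. Qed.

Lemma homR x y : f [~ x, y] = [~ f x, f y].
Proof. by rewrite /commg /conjg !gmulfM !homV. Qed.

Lemma hom_inj : (forall x, f x = 1 -> x = 1) -> injective f.
Proof. by move=> fI x y xy; apply/divg1_eq/fI; rewrite gmulfM homV xy mulgV. Qed.
End Hom.

Lemma hom_comp_subproof (X Y Z : groupType) (g : {multiplicative Y -> Z})
  (f : {multiplicative X -> Y}) : {morph (fun x => g (f x)) : x y / x * y}.
Proof. by move=> x y; rewrite !gmulfM. Qed.
Definition hom_comp (X Y Z : groupType) g f : {multiplicative X -> Z} :=
  hom (@hom_comp_subproof X Y Z g f).

Definition hom_triv (X Y : groupType) : {multiplicative X -> Y} :=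
  hom (fun x y : X => esym (mulg1 (1 : Y))).

(** A subgroup, as a set; [subgroup_pred] turns it into a [groupClosed]
    predicate, so that subgroups may be given by arbitrary propositions. *)
Record subgroup_set (X : groupType) (A : set X) : Prop := SubgroupSet {
  sg1 : A 1;
  sgM : forall x y, A x -> A y -> A (x * y);
  sgV : forall x, A x -> A x^-1 }.

Section SubgroupPred.
Variables (X : groupType) (A : set X) (gA : subgroup_set A).

Definition sg_pred of subgroup_set A : {pred X} := [pred x | `[< A x >]].

Lemma sg_predM : mulg_closed (sg_pred gA).
Proof.
move=> x y /= /asboolP Ax /asboolP Ay; apply/asboolP; exact: sgM gA _ _ Ax Ay.
Qed.
Lemma sg_pred1 : 1 \in sg_pred gA.
Proof. apply/asboolP; exact: sg1 gA. Qed.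
Lemma sg_predV : invg_closed (sg_pred gA).
Proof. move=> x /= /asboolP Ax; apply/asboolP; exact: sgV gA _ Ax. Qed.

HB.instance Definition _ := isMulClosed.Build X (sg_pred gA) sg_predM.
HB.instance Definition _ := isMul1Closed.Build X (sg_pred gA) sg_pred1.
HB.instance Definition _ := isInvClosed.Build X (sg_pred gA) sg_predV.
Definition subgroup_pred : groupClosed X := sg_pred gA.

Lemma subgroup_predP x : x \in subgroup_pred <-> A x.
Proof. by split=> [/asboolP|?]; last exact/asboolP. Qed.
End SubgroupPred.

Lemma groupClosed_set (X : groupType) (N : groupClosed X) :
  subgroup_set [set x | x \in N].
Proof.
split=> [|x y|x]; first exact: gpred1; first exact: gpredM.
by rewrite /= gpredV.
Qed.

Definition normal_set (X : groupType) (A : set X) :=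
  forall x g : X, A x -> A (x ^ g).

Lemma normal_subgroup_pred (X : groupType) (A : set X) (gA : subgroup_set A) :
  normal_set A -> normal (subgroup_pred gA).
Proof. by move=> nA x g /subgroup_predP Ax; apply/subgroup_predP/nA. Qed.

Arguments normal_subgroup_pred {X A} gA.

Definition ker (X Y : groupType) (f : {multiplicative X -> Y}) : set X :=
  [set x | f x = 1].

Lemma ker_subgroup (X Y : groupType) (f : {multiplicative X -> Y}) : subgroup_set (ker f).
Proof.
split=> [|x y fx fy|x fx]; rewrite /ker /= ?hom1 ?gmulfM ?homV ?fx ?fy ?mulg1 //.
exact: invg1.
Qed.

Lemma ker_normal (X Y : groupType) (f : {multiplicative X -> Y}) : normal_set (ker f).
Proof.
by move=> x g fx; rewrite /ker /= /conjg !gmulfM homV fx mul1g mulVg.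
Qed.

Lemma range_subgroup (X Y : groupType) (f : {multiplicative X -> Y}) : subgroup_set (range f).
Proof.
split=> [|_ _ [x _ <-] [y _ <-]|_ [x _ <-]].
- by exists 1; rewrite ?hom1.
- by exists (x * y); rewrite ?gmulfM.
- by exists x^-1; rewrite ?homV.
Qed.

Section Zexp.
Variable X : groupType.
Implicit Types (x y : X) (a b : int).

Definition zexp x a : X :=
  match a with Posz n => x ^+ n | Negz n => x ^- n.+1 end.

Lemma zexp0 x : zexp x 0 = 1. Proof. by []. Qed.
Lemma zexp1 x : zexp x 1 = x. Proof. by []. Qed.

Lemma zexp_succ x a : zexp x (a + 1)%R = zexp x a * x.
Proof.
case: a => n; first by rewrite -[RHS]expgSr -addn1.
have -> : (Negz n + 1 = - Posz n)%R by lia.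
by case: n => [|n] /=; rewrite ?expg1 ?mulVg // (expgS x n.+1) invgM mulgVK.
Qed.

Lemma zexp_pred x a : zexp x (a - 1)%R = zexp x a / x.
Proof. by rewrite -[in RHS](GRing.subrK 1%R a) zexp_succ mulgK. Qed.

Lemma zexpD x a b : zexp x (a + b)%R = zexp x a * zexp x b.
Proof.
elim/int_ind: b => [|n IHn|n IHn]; first by rewrite GRing.addr0 mulg1.
  have -> : (a + Posz n.+1 = (a + Posz n) + 1)%R by lia.
  have -> : (Posz n.+1 = Posz n + 1 :> int)%R by lia.
  by rewrite !zexp_succ IHn mulgA.
have -> : (a - Posz n.+1 = (a - Posz n) - 1)%R by lia.
have -> : (- Posz n.+1 = (- Posz n) - 1 :> int)%R by lia.
by rewrite !zexp_pred IHn mulgA.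
Qed.

Lemma zexpN x a : zexp x (- a)%R = (zexp x a)^-1.
Proof. by apply/esym/mulg1_eq; rewrite -zexpD GRing.subrr. Qed.

Lemma zexpB x a b : zexp x (a - b)%R = zexp x a / zexp x b.
Proof. by rewrite zexpD zexpN. Qed.

Lemma zexpM x a b : zexp x (a * b)%R = zexp (zexp x a) b.
Proof.
elim/int_ind: b => [|n IHn|n IHn]; first by rewrite GRing.mulr0.
  have -> : (Posz n.+1 = Posz n + 1 :> int)%R by lia.
  by rewrite zexp_succ -IHn -zexpD GRing.mulrDr GRing.mulr1.
have -> : (- Posz n.+1 = (- Posz n) - 1 :> int)%R by lia.
by rewrite zexp_pred -IHn -zexpB GRing.mulrBr GRing.mulr1.
Qed.

Lemma zexp1g a : zexp (1 : X) a = 1.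
Proof. by case: a => n; rewrite /= expg1n ?invg1. Qed.

Lemma zexp_nat x (n : nat) : zexp x n = x ^+ n. Proof. by []. Qed.

Lemma commute_zexp x y a : commute x y -> commute x (zexp y a).
Proof. by case: a => n xy; [exact: commuteX|apply/commuteV/commuteX]. Qed.

Lemma zexpMg x y a : commute x y -> zexp (x * y) a = zexp x a * zexp y a.
Proof.
move=> xy; case: a => n /=; first exact: expgMn.
by rewrite expgMn // -invgM (commuteX2 n.+1 n.+1 xy).
Qed.

Lemma zexpV x a : zexp x^-1 a = (zexp x a)^-1.
Proof. by case: a => n; rewrite /= expVgn. Qed.

Lemma zexp_abs1 x a : zexp x a = 1 -> x ^+ `|a|%N = 1.
Proof. by case: a => n //= /eqP; rewrite invg_eq1 => /eqP. Qed.

Lemma zexp_mod x (n : nat) a b : x ^+ n = 1 -> zexp x (a + Posz n * b)%R = zexp x a.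
Proof. by move=> xn; rewrite zexpD zexpM zexp_nat xn zexp1g mulg1. Qed.
End Zexp.

Lemma homZ (X Y : groupType) (f : {multiplicative X -> Y}) x a :
  f (zexp x a) = zexp (f x) a.
Proof. by case: a => n /=; rewrite ?homV homX. Qed.

Lemma conj_zexp (X : groupType) (x y : X) a : zexp x a ^ y = zexp (x ^ y) a.
Proof. by case: a => n /=; rewrite ?conjVg conjXg. Qed.

Lemma int_euclid (a : int) (m : nat) : (0 < m)%N ->
  exists i : nat, exists q : int, (i < m)%N /\ (a = Posz i + q * Posz m)%R.
Proof.
move=> m_gt0; have lt_mod j : (j %% m < m)%N by rewrite ltn_mod.
case: a => j.
  exists (j %% m)%N, (Posz (j %/ m)); split=> //.
  by rewrite {1}(divn_eq j m); lia.
exists (m - (j %% m).+1)%N, (- Posz (j %/ m).+1)%R; split; first by lia.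
by have := divn_eq j m; have := lt_mod j; lia.
Qed.

Lemma trivial_subgroup (X : groupType) : subgroup_set [set 1 : X].
Proof. by split=> [|x y -> ->|x ->] //=; rewrite ?mulg1 ?invg1. Qed.

Lemma sg_zexp (X : groupType) (A : set X) x a : subgroup_set A -> A x -> A (zexp x a).
Proof.
move=> gA Ax; have AX n : A (x ^+ n).
  by elim: n => [|n IHn]; rewrite ?expgS; [exact: sg1 gA|exact: sgM gA _ _ Ax IHn].
by case: a => n; rewrite /zexp //; apply: (sgV gA).
Qed.

Lemma sg_coprime (X : groupType) (A : set X) x m n : subgroup_set A ->
  coprime m n -> A (x ^+ m) -> A (x ^+ n) -> A x.
Proof.
move=> gA co Am An; have [m0|m_gt0] := posnP m.
  by move: co An; rewrite m0 /coprime gcd0n => /eqP ->; rewrite expg1.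
case: (egcdnP n m_gt0) => u v def _; move: def; rewrite (eqP co) => def.
have : x = zexp (x ^+ m) (Posz u) * (zexp (x ^+ n) (Posz v))^-1.
  by apply: (canRL (mulgK _)); rewrite /= -!expgnA -expgS -addn1 (mulnC m) (mulnC n) def addnC.
by move=> ->; apply: (sgM gA); last apply: (sgV gA); exact: sg_zexp.
Qed.

Lemma coprime_expg1 (X : groupType) (x : X) m n :
  coprime m n -> x ^+ m = 1 -> x ^+ n = 1 -> x = 1.
Proof. exact: sg_coprime (trivial_subgroup X). Qed.

Lemma order_exists (X : groupType) (x : X) N :
  (0 < N)%N -> x ^+ N = 1 -> exists n, has_order x n.
Proof.
move=> N_gt0 xN; have ex : exists n, (0 < n)%N && (x ^+ n == 1).
  by exists N; rewrite N_gt0 xN eqxx.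
case: (ex_minnP ex) => n /andP[n_gt0 /eqP xn] minn; exists n; split=> // m m_gt0 xm.
by apply: minn; rewrite m_gt0 xm eqxx.
Qed.

Lemma order_dvd (X : groupType) (x : X) n m :
  has_order x n -> x ^+ m = 1 -> (n %| m)%N.
Proof.
case=> n_gt0 xn minn xm; rewrite /dvdn -leqn0 leqNgt; apply/negP => r_gt0.
have := ltn_pmod m n_gt0; rewrite ltnNge minn //.
by move: xm; rewrite {1}(divn_eq m n) expgnDr mulnC expgnA xn expg1n mul1g.
Qed.

Section SubQuotHom.
Variables (X Y : groupType) (f : {multiplicative X -> Y}).

Lemma corestr_subproof (A : groupClosed Y) (fA : forall x, f x \in A) :
  {morph (fun x => Subg (fA x)) : x y / x * y}.
Proof. by move=> x y; apply: val_inj; rewrite valM /= gmulfM. Qed.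
Definition corestr A fA : {multiplicative X -> subg A} :=
  hom (@corestr_subproof A fA).

Lemma quot_lift_subproof (N : groupClosed X) (nN : normal N)
    (fN : forall x, x \in N -> f x = 1) :
  {morph (fun x : quotg nN => f (quotg_repr x)) : x y / x * y}.
Proof.
have lift x y : quotg_proj nN x = quotg_proj nN y -> f x = f y.
  move=> /quotg_projP /fN; rewrite gmulfM homV => /(congr1 (mul (f x))).
  by rewrite mulVKg mulg1.
move=> x y; rewrite -gmulfM; apply: lift.
by rewrite gmulfM /= !quotg_reprK.
Qed.
Definition quot_lift (N : groupClosed X) (nN : normal N) fN : {multiplicative quotg nN -> Y} :=
  hom (@quot_lift_subproof N nN fN).

Lemma quot_liftE (N : groupClosed X) (nN : normal N) fN x :
  @quot_lift N nN fN (quotg_proj nN x) = f x.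
Proof.
have := quotg_reprK (quotg_proj nN x).
move=> /quotg_projP /fN; rewrite gmulfM homV => /(congr1 (mul (f (quotg_repr (quotg_proj nN x))))).
by rewrite mulVKg mulg1.
Qed.
End SubQuotHom.

Lemma quotg_proj1 (X : groupType) (N : groupClosed X) (nN : normal N) x :
  quotg_proj nN x = 1 <-> x \in N.
Proof.
rewrite -(hom1 (quotg_proj nN)); split=> [/esym/quotg_projP|xN].
  by rewrite invg1 mul1g.
by apply/esym/quotg_projP; rewrite invg1 mul1g.
Qed.

Definition subg_incl (X : groupType) (A : groupClosed X) :
  {multiplicative subg A -> X} := hom (fun x y : subg A => valM x y).

(** * Root classes *)

(** The unrestricted regular wreath product: [T] acts on the functions
    [T -> M] by translation of their argument. *)
Definition wreath (M T : groupType) : Type := ((T -> M) * T)%type.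

Section Wreath.
Variables (M T : groupType).
Local Notation W := (wreath M T).
Implicit Types u v w : W.

HB.instance Definition _ := Choice.copy W ((T -> M) * T)%type.

Definition wr_one : W := (fun=> 1, 1).
Definition wr_mul u v : W := (fun x => u.1 x * v.1 (x * u.2), u.2 * v.2).
Definition wr_inv u : W := (fun x => (u.1 (x * u.2^-1))^-1, u.2^-1).

Lemma wr_eq u v : (forall x, u.1 x = v.1 x) -> u.2 = v.2 -> u = v.
Proof. by case: u v => [f s] [g t] /= fg ->; congr pair; apply/funext. Qed.

Lemma wr_mulA : associative wr_mul.
Proof. by move=> u v w; apply: wr_eq => [x|] /=; rewrite !mulgA. Qed.
Lemma wr_mul1 : left_id wr_one wr_mul.
Proof. by move=> u; apply: wr_eq => [x|] /=; rewrite ?mulg1 mul1g. Qed.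
Lemma wr_mulr1 : right_id wr_one wr_mul.
Proof. by move=> u; apply: wr_eq => [x|] /=; rewrite mulg1. Qed.
Lemma wr_mulV : left_inverse wr_one wr_inv wr_mul.
Proof. by move=> u; apply: wr_eq => [x|] /=; rewrite mulVg. Qed.
Lemma wr_mulrV : right_inverse wr_one wr_inv wr_mul.
Proof. by move=> u; apply: wr_eq => [x|] /=; rewrite ?mulgK mulgV. Qed.

HB.instance Definition _ := isGroup.Build W wr_mulA wr_mul1 wr_mulr1 wr_mulV wr_mulrV.

Lemma wrM1 u v x : (u * v).1 x = u.1 x * v.1 (x * u.2). Proof. by []. Qed.
Lemma wrM2 u v : (u * v).2 = u.2 * v.2. Proof. by []. Qed.
Lemma wrV1 u x : (u^-1).1 x = (u.1 (x * u.2^-1))^-1. Proof. by []. Qed.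
Lemma wrV2 u : (u^-1).2 = u.2^-1. Proof. by []. Qed.

Lemma wr_snd_morph : {morph (fun u : W => u.2) : u v / u * v}.
Proof. by []. Qed.
Definition wr_snd : {multiplicative W -> T} := hom wr_snd_morph.

(** Constant functions are fixed by [T], so that the direct product of [M] and
    [T] sits inside the wreath product. *)
Lemma wr_pair_morph (X : groupType) (f : {multiplicative X -> M})
    (g : {multiplicative X -> T}) :
  {morph (fun x => (fun=> f x, g x) : W) : x y / x * y}.
Proof. by move=> x y; apply: wr_eq => [z|]; rewrite /= gmulfM. Qed.
Definition wr_pair (X : groupType) f g : {multiplicative X -> W} :=
  hom (@wr_pair_morph X f g).
End Wreath.

(** This closure property is all that the detection of reduced words asks of a
    class. Root classes have it, and so has the class of all groups. *)
Definition wreath_closed (C : group_class) :=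
  forall M T : groupType, C M -> C T -> C (wreath M T).

Section RootClass.
Variables (C : group_class) (rootC : root_class C).

Lemma root_iso (X Y : groupType) (f : {multiplicative X -> Y}) :
  bijective f -> C X -> C Y.
Proof. by case: rootC => iso _ _ _ _ bij; apply: iso; exists f. Qed.

Lemma root_subg (X : groupType) (A : groupClosed X) : C X -> C (subg A).
Proof. by case: rootC => _ _ + _ _; apply. Qed.

Lemma root_inj (X Y : groupType) (f : {multiplicative X -> Y}) :
  injective f -> C Y -> C X.
Proof.
move=> injf CY; pose A := subgroup_pred (range_subgroup f).
have fA x : f x \in A by apply/subgroup_predP; exists x.
have preim (y : subg A) : exists x, f x = val y.
  by case: y => y /= /subgroup_predP[x _ fx]; exists x.
have [g fg] := choice preim.
have gM : {morph g : x y / x * y}.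
  by move=> x y; apply: injf; rewrite gmulfM !fg valM.
apply: (@root_iso _ _ (hom gM)); last exact: root_subg CY.
exists (fun x => Subg (fA x)) => [y|x]; first by apply: val_inj; rewrite /= fg.
by apply: injf; rewrite /= fg.
Qed.

Lemma root_ext (X Y : groupType) (f : {multiplicative X -> Y}) :
  C Y -> C (subg (subgroup_pred (ker_subgroup f))) -> C X.
Proof.
move=> CY Cker; have nK := normal_subgroup_pred (ker_subgroup f) (@ker_normal _ _ f).
case: rootC => _ _ _ ext _; apply: (ext X _ nK) => //.
have fK x : x \in subgroup_pred (ker_subgroup f) -> f x = 1 by move/subgroup_predP.
apply: (@root_inj _ _ (quot_lift nK fK)) => //; apply: hom_inj => x.
rewrite -(quotg_reprK x) quot_liftE => fx.
by apply/quotg_proj1/subgroup_predP.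
Qed.

Lemma root_power (M T : groupType) : C M -> C T -> C (cartesian (fun _ : T => M)).
Proof.
move=> CM CT; case: rootC => _ _ _ _ cart; apply: (cart M T) => // _.
by exists (hom (fun x y : M => erefl (x * y))); exists id.
Qed.

Lemma root_wreath : wreath_closed C.
Proof.
move=> M T CM CT; apply: (root_ext (f := wr_snd M T)) => //.
set K := subgroup_pred _.
have K2 (u : subg K) : (val u).2 = 1 by case: u => u /= /subgroup_predP.
have jM : {morph (fun u : subg K => (val u).1 : cartesian (fun _ : T => M)) :
             u v / u * v}.
  by move=> u v; apply/funext => x; rewrite valM wrM1 K2 mulg1.
apply: (@root_inj _ _ (hom jM)); last exact: root_power.
move=> u v uv; apply: val_inj; apply: wr_eq => [x|]; last by rewrite !K2.
exact: (congr1 (fun g => g x) uv).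
Qed.

Lemma root_prod (X Y : groupType) : C X -> C Y -> C (X * Y)%type.
Proof.
move=> CX CY; have fstM : {morph (@fst X Y) : x y / x * y} by [].
have sndM : {morph (@snd X Y) : x y / x * y} by [].
apply: (root_ext (f := hom sndM)) => //.
apply: (@root_inj _ _ (hom_comp (hom fstM) (subg_incl _))) => // u v /= uv.
apply: val_inj; apply: injective_projections => //.
have /subgroup_predP u1 := valP u; have /subgroup_predP v1 := valP v.
exact: etrans u1 (esym v1).
Qed.

End RootClass.

Lemma residually_hom (C : group_class) (rootC : root_class C) (X Y : groupType)
    (f : {multiplicative X -> Y}) (x : X) : C Y -> f x <> 1 ->
  exists (Z : groupType) (g : {multiplicative X -> Z}),
    [/\ C Z, surjective_map g & g x <> 1].
Proof.
move=> CY fx; pose A := subgroup_pred (range_subgroup f).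
have fA y : f y \in A by apply/subgroup_predP; exists y.
exists (subg A), (corestr fA); split; first exact: root_subg.
  case=> y yA; have /subgroup_predP[z _ fz] := yA; exists z; exact: val_inj.
by move=> /(congr1 val).
Qed.

(** * Cyclic groups in a root class *)

Lemma subgX (X : groupType) (A : groupClosed X) (u : subg A) n : val (u ^+ n) = val u ^+ n.
Proof. exact: (homX (subg_incl A) u n). Qed.

Definition cyclic_set (X : groupType) (x : X) : set X := range (zexp x).

Lemma cyclic_subgroup_set (X : groupType) (x : X) : subgroup_set (cyclic_set x).
Proof.
split=> [|_ _ [a _ <-] [b _ <-]|_ [a _ <-]].
- by exists 0%R.
- by exists (a + b)%R; rewrite ?zexpD.
- by exists (- a)%R; rewrite ?zexpN.
Qed.

Lemma primes_of_prime (C : group_class) p : primes_of C p -> prime p.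
Proof. by case. Qed.

Lemma prime_order_mem (C : group_class) (X : groupType) (x : X) n p :
  C X -> has_order x n -> prime p -> (p %| n)%N -> primes_of C p.
Proof. by move=> CX xn p_pr p_n; split=> //; exists X, x, n. Qed.

Lemma has_order_div (X : groupType) (x : X) n d :
  has_order x n -> (d %| n)%N -> has_order (x ^+ (n %/ d)) d.
Proof.
case=> n_gt0 xn minn d_n; have d_gt0 := dvdn_gt0 n_gt0 d_n.
split=> //; first by rewrite -expgnA divnK.
move=> m m_gt0; rewrite -expgnA => /(order_dvd (And3 n_gt0 xn minn)) dvd.
have nd_gt0 : (0 < n %/ d)%N by rewrite divn_gt0 // dvdn_leq.
rewrite leqNgt; apply/negP => lt_md.
have := dvdn_leq _ dvd; rewrite muln_gt0 nd_gt0 m_gt0 => /(_ isT).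
by rewrite leqNgt -{2}(divnK d_n) ltn_pmul2l // lt_md.
Qed.

Lemma cyclic_commute (M : groupType) (l : M) :
  (forall x, exists a, x = zexp l a) -> forall x y : M, commute x y.
Proof.
move=> cyc x y; have [a ->] := cyc x; have [b ->] := cyc y.
by rewrite /commute -!zexpD GRing.addrC.
Qed.

Lemma cyclic_exponent (M : groupType) (l : M) n : l ^+ n = 1 ->
  (forall x, exists a, x = zexp l a) -> forall x : M, x ^+ n = 1.
Proof.
move=> ln cyc x; have [a ->] := cyc x.
by rewrite -zexp_nat -zexpM GRing.mulrC zexpM zexp_nat ln zexp1g.
Qed.

Lemma root_cyclic_order (C : group_class) (rootC : root_class C) (X : groupType) (y : X) n :
    C X -> has_order y n -> exists (M : groupType) (l : M),
  [/\ C M, has_order l n & forall x, exists a, x = zexp l a].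
Proof.
move=> CX [n_gt0 yn miny]; pose A := subgroup_pred (cyclic_subgroup_set y).
have yA : y \in A by apply/subgroup_predP; exists 1%R.
exists (subg A), (Subg yA); split; first exact: root_subg.
  split=> // [|m m_gt0 ym]; first by apply: val_inj; rewrite subgX.
  by apply: miny => //; rewrite -[y]/(val (Subg yA)) -subgX ym.
case=> u uA; have /subgroup_predP[a _ ya] := uA; exists a; apply: val_inj.
by rewrite -[RHS]/(subg_incl A (zexp (Subg yA) a)) homZ.
Qed.

Section Cyclic.
Variables (C : group_class) (rootC : root_class C) (p : nat) (Cp : primes_of C p).
Let p_pr : prime p := primes_of_prime Cp.

Lemma root_cyclic_prime : exists (V : groupType) (v : V),
  [/\ C V, has_order v p & forall x, exists a, x = zexp v a].
Proof.
case: Cp => _ [X [x [n [CX xn p_n]]]].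
exact: root_cyclic_order (has_order_div xn p_n).
Qed.

(** An element [y] of order [p ^ s] yields the element [(delta_1 v, y)] of
    order [p ^ s.+1] in a wreath product, because the [p ^ s]-th power of the
    latter collects the single value [v] along the cycle of [y]. *)
Lemma root_element_ppower s : exists (X : groupType) (x : X), C X /\ has_order x (p ^ s).
Proof.
have [V [v [CV [_ vp minv] /(cyclic_exponent vp) Vp]]] := root_cyclic_prime.
elim: s => [|s [T [y [CT oy]]]]; first by exists V, 1; do !split.
have [N_gt0 yN miny] := oy.
pose z : wreath V T := (fun x => if x == 1 then v else 1, y).
have z2 n : (z ^+ n).2 = y ^+ n := homX (wr_snd V T) z n.
have zwalk n j : (0 < j)%N -> (j + n <= p ^ s)%N -> (z ^+ n).1 (y ^+ j) = 1.
  elim: n j => // n IHn j j_gt0 le_jn; rewrite expgS wrM1 /= -expgSr IHn //; last by lia.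
  by case: eqP => [/(miny j j_gt0)|_]; rewrite ?mulg1 //; lia.
have zN1 : (z ^+ (p ^ s)).1 1 = v.
  rewrite -(prednK N_gt0) expgS wrM1 /= eqxx mul1g -[y]expg1 zwalk ?mulg1 //.
  by rewrite add1n prednK.
have fpow (u : wreath V T) n x : u.2 = 1 -> (u ^+ n).1 x = u.1 x ^+ n.
  by move=> u2; elim: n => // n IHn; rewrite !expgS wrM1 u2 mulg1 IHn.
exists (wreath V T), z; split; first exact: root_wreath.
have zpN : z ^+ (p ^ s.+1) = 1.
  rewrite expnSr expgnA; apply: wr_eq => [x|]; last by rewrite -expgnA z2 expgnA yN expg1n.
  by rewrite fpow ?Vp // z2.
have pp_gt0 i : (0 < p ^ i)%N by rewrite expn_gt0 prime_gt0.
have [n on] := order_exists (pp_gt0 s.+1) zpN.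
have /(dvdn_pfactor _ _ p_pr)[i le_i n_pi] := order_dvd on zpN.
have le_si : (s <= i)%N.
  rewrite -(dvdn_Pexp2l _ _ (prime_gt1 p_pr)) -n_pi; apply: (order_dvd oy).
  by case: on => _ zn _; rewrite -z2 zn.
have [eq_is|ne_is] := eqVneq i s.
  case: on => _ + _; rewrite n_pi eq_is => zn.
  by move: (minv 1%N isT); rewrite expg1 -zN1 zn => /(_ erefl); rewrite leqNgt prime_gt1.
by rewrite (_ : s.+1 = i) -?n_pi //; lia.
Qed.

Lemma root_cyclic_ppower s : exists (M : groupType) (l : M),
  [/\ C M, has_order l (p ^ s) & forall x, exists a, x = zexp l a].
Proof.
have [X [y [CX oy]]] := root_element_ppower s.
exact: root_cyclic_order CX oy.
Qed.
End Cyclic.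

Lemma order_dvdz (X : groupType) (x : X) n (a : int) :
  has_order x n -> zexp x a = 1 -> (n %| `|a|)%N.
Proof. by move=> xn /zexp_abs1; exact: order_dvd. Qed.

(** * Reduced words in free groups *)

Definition sgn (X : groupType) (b : bool) (x : X) : X := if b then x else x^-1.

Section FreeWords.
Variable E : eqType.
Implicit Type l : seq (E * bool).

Fixpoint wprod (V : groupType) (F : E -> V) l : V :=
  if l is (e, b) :: l' then sgn b (F e) * wprod F l' else 1.

Definition free_reduced := sorted (fun a b : E * bool => (a.1 == b.1) ==> (a.2 == b.2)).

Lemma wprod_cat (V : groupType) (F : E -> V) l l' :
  wprod F (l ++ l') = wprod F l * wprod F l'.
Proof. by elim: l => [|[e b] l IHl] /=; rewrite ?mul1g // IHl mulgA. Qed.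

Lemma hom_sgn (X Y : groupType) (f : {multiplicative X -> Y}) b x :
  f (sgn b x) = sgn b (f x).
Proof. by case: b; rewrite /= ?homV. Qed.

Lemma hom_wprod (V W : groupType) (f : {multiplicative V -> W}) (F : E -> V) l :
  f (wprod F l) = wprod (f \o F) l.
Proof. by elim: l => [|[e b] l IHl] /=; rewrite ?hom1 // gmulfM hom_sgn IHl. Qed.

Variables (C : group_class) (wrC : wreath_closed C).
Variables (V0 : groupType) (v : V0) (CV0 : C V0) (v_neq1 : v <> 1).

(** Suppose every proper nonempty factor of [l] is already nontrivial in [U],
    so that the walk spelled by [l] in the Cayley graph of [U] visits distinct
    vertices, except that it may be closed. Then it runs exactly once along its
    first edge, and a wreath product whose base function is supported on that
    edge detects it. *)
Lemma wreath_unwind (U : groupType) (F : E -> U) e1 b1 l :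
    free_reduced ((e1, b1) :: l) ->
    (forall s, infix s ((e1, b1) :: l) -> s <> [::] -> s <> (e1, b1) :: l ->
       wprod F s <> 1) ->
    wprod F ((e1, b1) :: l) = 1 ->
  exists F' : E -> wreath V0 U,
    (forall e, (F' e).2 = F e) /\ wprod F' ((e1, b1) :: l) <> 1.
Proof.
set w := (e1, b1) :: l => red_w propF w1.
pose x1 := if b1 then 1 else (F e1)^-1.
pose phi e x := if (e == e1) && (x == x1) then v else 1.
pose F' e : wreath V0 U := (phi e, F e).
have F'2 s : (wprod F' s).2 = wprod F s by rewrite (hom_wprod (wr_snd V0 U)).
exists F'; split=> //.
have proper p s' q : w = p ++ s' ++ q -> s' <> [::] -> (0 < size p + size q)%N ->
    wprod F s' <> 1.
  move=> defw s'n0 pq; apply: propF => // [|eq_w]; first by apply/infixP; exists p, q.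
  by move/(congr1 size): defw; rewrite !size_cat -eq_w; lia.
have walk s p : w = p ++ s -> p <> [::] -> (wprod F' s).1 (wprod F p) = 1.
  elim: s p => // [[e b] s] IHs p defw p_n0.
  have defw' : w = rcons p (e, b) ++ s by rewrite cat_rcons.
  rewrite -[wprod F' ((e, b) :: s)]/(sgn b (F' e) * wprod F' s) wrM1.
  have := IHs _ defw'; rewrite -cats1 wprod_cat -[wprod F [:: _]]/(sgn b (F e) * 1) mulg1.
  have -> : (sgn b (F' e)).2 = sgn b (F e) by case: (b).
  case: p p_n0 defw defw' => // -[e' b'] p _ defw defw'.
  have [ee' bb'] : e' = e1 /\ b' = b1 by case: defw.
  rewrite {}ee' {}bb' in defw defw' *.
  move=> -> //; rewrite mulg1.
  set x := wprod F ((e1, b1) :: p).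
  suff H : ~ (e = e1 /\ (if b then x else x / F e) = x1).
    have {}H : (e == e1) && ((if b then x else x / F e) == x1) = false.
      by apply/negP => /andP[/eqP ? /eqP ?]; apply: H.
    by case: (b) H => H; rewrite /= ?wrV1 /= /phi H ?invg1.
  case=> ee1; rewrite {}ee1 in defw defw' *; rewrite /x /=.
  have pfx : wprod F p = 1 -> p = [::].
    move=> Fp; case: (eqVneq p [::]) => // /eqP pn0.
    by case: (proper [:: (e1, b1)] p ((e1, b) :: s)).
  have adj : p = [::] -> b1 = b.
    move=> p0; move: red_w; rewrite /free_reduced defw p0 /= eqxx /=.
    by case/andP => /eqP.
  have size_w : size w = (size p + size s).+2 by rewrite defw /= size_cat /= addnS.
  rewrite /x1; have [hb|/negbTE hb] := boolP b; have [hb1|/negbTE hb1] := boolP b1;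
    rewrite /= ?hb ?hb1 /= -?mulgA.
  - move=> Fp; apply: (proper [::] ((e1, b1) :: p) ((e1, b) :: s)) => //=.
    by rewrite /= hb1.
  - move=> Fp; have /pfx/adj : wprod F p = 1; last by congruence.
    by apply: (mulgI (F e1)^-1); rewrite mulg1.
  - move=> Fp; have [s0|s_n0] := eqVneq s [::]; last first.
      have sz : (0 < size ([::] : seq (E * bool)) + size s)%N by case: (s) s_n0.
      apply: (proper [::] ((e1, b1) :: rcons p (e1, b)) s defw' _ sz) => //.
      by rewrite -cats1 /= wprod_cat /= hb hb1 /= mulg1.
    have /pfx/adj : wprod F p = 1; last by congruence.
    by apply: (mulgI (F e1)); apply: (mulIg (F e1)^-1); rewrite mulg1 mulgV -mulgA.
  - move=> Fp; apply: (proper [:: (e1, b1)] (rcons p (e1, b)) s) => //.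
      by move/(congr1 size); rewrite size_rcons.
    rewrite -cats1 wprod_cat /= hb /= mulg1.
    by apply: (mulgI (F e1)^-1); rewrite mulg1.
have := walk l [:: (e1, b1)] erefl.
rewrite -[wprod F' w]/(sgn b1 (F' e1) * wprod F' l) => wl wF'.
have := congr1 (fun u : wreath V0 U => u.1 1) wF'; rewrite wrM1.
have -> : 1 * (sgn b1 (F' e1)).2 = wprod F [:: (e1, b1)].
  by rewrite /= mulg1 mul1g; case: (b1).
rewrite wl // mulg1 => first_edge; apply: v_neq1.
move: first_edge; rewrite /F' /phi /x1; case: (b1) => /=; first by rewrite !eqxx.
by rewrite mul1g !eqxx => /eqP; rewrite invg_eq1 => /eqP.
Qed.

(** Induction on the length: the words obtained by deleting the first or the
    last letter are treated simultaneously in a wreath product of two groups,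
    and if the whole word is still trivial there, the walk is unwound once. *)
Lemma free_word_separated l : free_reduced l ->
  exists (V : groupType) (F : E -> V), C V /\
    forall s, infix s l -> s <> [::] -> wprod F s <> 1.
Proof.
have [n] := ubnP (size l); elim: n l => // n IHn [|[e1 b1] l] size_l red_l.
  by exists V0, (fun=> 1); split=> // -[].
set w := (e1, b1) :: l.
have [|V1 [F1 [CV1 sep1]]] := IHn l size_l; first exact: path_sorted red_l.
have [||V2 [F2 [CV2 sep2]]] := IHn (take (size l) w).
- by rewrite size_take /= ltnSn.
- exact: take_sorted.
pose U := wreath V1 V2; pose F e : U := (fun=> F1 e, F2 e).
have CU : C U by exact: wrC.
have F2E s : (wprod F s).2 = wprod F2 s by rewrite (hom_wprod (wr_snd V1 V2)).
have F1E s x : (wprod F s).1 x = wprod F1 s.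
  by elim: s x => [|[e [|]] s IHs] x //=; rewrite IHs.
have propF s : infix s w -> s <> [::] -> s <> w -> wprod F s <> 1.
  move=> /infixP[p [q defw]] s_n0 s_w Fs.
  have [p0|p_n0] := eqVneq p [::].
    have [q0|q_n0] := eqVneq q [::]; first by apply: s_w; rewrite defw p0 q0 cats0.
    apply: (sep2 s) => //; last by rewrite -F2E Fs.
    apply/infixP; exists [::], (take (size l - size s) q).
    rewrite defw p0 /= take_cat ifN //; rewrite -leqNgt.
    have := congr1 size defw; rewrite p0 /w /= size_cat.
    by case: (q) q_n0 => [//|a q' _] /=; lia.
  apply: (sep1 s) => //; last by rewrite -(F1E s 1) Fs.
  case: p p_n0 defw => // a p _ [_ ->]; apply/infixP; by exists p, q.
have [w1|wn1] := pselect (wprod F w = 1).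
  have [F' [F'2 F'w]] := wreath_unwind red_l propF w1.
  exists (wreath V0 U), F'; split; first exact: wrC.
  move=> s s_w s_n0; have [->//|/eqP ne_sw] := eqVneq s w.
  move=> F's; apply: (propF s s_w s_n0 ne_sw).
  have <- : wr_snd V0 U \o F' = F by apply/funext => e; exact: F'2.
  by rewrite -hom_wprod F's hom1.
exists U, F; split=> // s s_w s_n0; have [->//|/eqP ne_sw] := eqVneq s w.
exact: propF.
Qed.
End FreeWords.

(** * Reduced words in HNN-extensions *)

Section HNNWords.
Variables (G : groupType) (H K : groupClosed G).
Variable phi : {multiplicative subg H -> subg K}.
Local Notation hnn := (hnn phi).
Local Notation inc := (hnn_incl phi : {multiplicative G -> hnn}).
Local Notation t := (hnn_t phi).

(** The universal property of the presentation. *)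
Section Lift.
Variables (B : groupType) (rho : {multiplicative G -> B}) (tau : B).
Hypothesis rel_tau : forall h : subg H,
  tau^-1 * rho (val h) * tau = rho (val (phi h)).

Fixpoint word_eval (u : hnn_word G) : B :=
  match u with
  | HnnOne => 1
  | HnnMul u v => word_eval u * word_eval v
  | HnnInv u => (word_eval u)^-1
  | HnnGen x => rho x
  | HnnT => tau
  end.

Lemma word_eval_cong u v : hnn_cong phi u v -> word_eval u = word_eval v.
Proof.
elim=> {u v} //=.
- by move=> u v w _ -> _ ->.
- by move=> u u' v v' _ -> _ ->.
- by move=> u u' _ ->.
- by move=> u v w; rewrite mulgA.
- by move=> u; rewrite mul1g.
- by move=> u; rewrite mulg1.
- by move=> u; rewrite mulVg.
- by move=> u; rewrite mulgV.
- by move=> x y; rewrite gmulfM.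
Qed.

Definition hnn_eval (x : hnn) : B := word_eval (hnn_repr x).

Lemma hnn_eval_proj u : hnn_eval (hnn_proj phi u) = word_eval u.
Proof. by apply: word_eval_cong; apply/hnn_projP/hnn_reprK. Qed.

Lemma hnn_eval_morph : {morph hnn_eval : x y / x * y}.
Proof.
move=> x y; rewrite -(hnn_reprK x) -(hnn_reprK y).
by rewrite -[_ * _]/(hnn_mul _ _) hnn_projM !hnn_eval_proj.
Qed.

Definition hnn_lift : {multiplicative hnn -> B} := hom hnn_eval_morph.

Lemma hnn_lift_incl x : hnn_lift (inc x) = rho x.
Proof. exact: hnn_eval_proj. Qed.

Lemma hnn_lift_t : hnn_lift t = tau.
Proof. exact: hnn_eval_proj. Qed.
End Lift.

Lemma hnn_ind (P : hnn -> Prop) :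
  (forall x, P (inc x)) -> P t -> (forall x y, P x -> P y -> P (x * y)) ->
  (forall x, P x -> P x^-1) -> forall x, P x.
Proof.
move=> Pi Pt PM PV x; rewrite -(hnn_reprK x); elim: (hnn_repr x) => {x}.
- by move: (Pi 1); rewrite hom1.
- by move=> u Pu v Pv; rewrite -hnn_projM; exact: PM.
- by move=> u Pu; rewrite -hnn_projV; exact: PV.
- exact: Pi.
- exact: Pt.
Qed.

Lemma conj_t_phi (h : subg H) : inc (val h) ^ t = inc (val (phi h)).
Proof. by rewrite /conjg mulgA; exact: hnn_stableE. Qed.

(** The list of pairs [(e, g)] stands for the product of the [t^(+-1) * g]. It
    is reduced if it contains no factor [t^-1 * g * t] with [g] in [H] and no
    factor [t * g * t^-1] with [g] in [K]. *)
Fixpoint hprod (l : seq (bool * G)) : hnn :=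
  if l is (e, g) :: l' then sgn e t * inc g * hprod l' else 1.

Definition pinch_free (a : bool * G) := if a.1 then a.2 \notin K else a.2 \notin H.

Definition hnn_reduced :=
  sorted (fun a b : bool * G => (a.1 == b.1) || pinch_free a).

Hypothesis phi_surj : forall k : subg K, exists h, phi h = k.

(** Multiplying a reduced word by a generator on the left either leaves it
    reduced or creates a pinch at its beginning, which can be removed. *)
Lemma hnn_reduced_form x : exists g l, hnn_reduced l /\ x = inc g * hprod l.
Proof.
pose R (x : hnn) := exists g l, hnn_reduced l /\ x = inc g * hprod l.
suff Rmul : forall y, (forall r, R r -> R (y * r)) /\ (forall r, R r -> R (y^-1 * r)).
  rewrite -[x]mulg1; apply: (proj1 (Rmul x)).
  by exists 1, [::]; split; rewrite // hom1 mul1g.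
have Rt e r : R r -> R (sgn e t * r).
  case=> g [l [redl ->]].
  case: l redl => [|[e' g'] l] redl.
    by exists 1, [:: (e, g)]; split; rewrite // hom1 mul1g /= mulgA.
  have [red|] := boolP ((e == e') || pinch_free (e, g)).
    exists 1, [:: (e, g), (e', g') & l]; split; first by rewrite /hnn_reduced /= red.
    by rewrite hom1 mul1g /= mulgA.
  rewrite negb_or => /andP[ee'].
  have tail : hnn_reduced l by exact: path_sorted redl.
  case: e e' ee' redl => [] [] //= _ redl; rewrite /pinch_free /= negbK => gin.
    have [h phih] := phi_surj (Subg gin).
    exists (val h * g'), l; split=> //; rewrite gmulfM.
    have := conj_t_phi h; rewrite phih /= => <-.
    by rewrite /conjg !mulgA mulgV mul1g mulgK.
  exists (val (phi (Subg gin)) * g'), l; split=> //; rewrite gmulfM -conj_t_phi.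
  by rewrite /conjg /= !mulgA.
elim/hnn_ind => [g| |y z [Ry RVy] [Rz RVz]|y [Ry RVy]].
- split=> _ [g' [l [redl ->]]]; [exists (g * g'), l | exists (g^-1 * g'), l];
  by split; rewrite // gmulfM ?homV mulgA.
- split=> r; [exact: (Rt true)|exact: (Rt false)].
- split=> r Rr; first by rewrite -mulgA; apply/Ry/Rz.
  by rewrite invgM -mulgA; apply/RVz/RVy.
- by split=> // r; rewrite invgK; exact: Ry.
Qed.

(** The subgroup that a syllable following [t] (for [e] true) or [t^-1] has to
    avoid. *)
Definition assoc_sub (e : bool) : groupClosed G := if e then K else H.

Variables (C : group_class) (wrC : wreath_closed C).
Variables (V0 : groupType) (v : V0) (CV0 : C V0) (v_neq1 : v <> 1).

Definition separates (B : groupType) (rho : hnn -> B) e g :=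
  forall x, x \in assoc_sub e -> rho (inc g) <> rho (inc x).

(** Let [rho] map the HNN-extension to [B]. Sending [t] to [(f, rho t)] and [g]
    to [(1, rho g)] defines a homomorphism to a wreath product over [B] as soon
    as [f] is constant on the left cosets of [rho H]. So [f] amounts to an
    arbitrary labelling of these cosets, and a reduced word that [rho] keeps
    pinch-free spells a reduced word in the free group on the cosets. *)
Lemma reduced_detected (B : groupType) (rho : {multiplicative hnn -> B}) g l :
    C B -> hnn_reduced l -> l <> [::] ->
    (forall e x, (e, x) \in l -> x \notin assoc_sub e -> separates rho e x) ->
  exists (W : groupType) (sigma : {multiplicative hnn -> W}),
    C W /\ sigma (inc g * hprod l) <> 1.
Proof.
move=> CB redl l_n0 sepl.
(* The labels are the left cosets of [rho H] in [B]. *)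
pose lc (x : B) : set B := [set y | exists2 h, h \in H & y = x * rho (inc h)].
have lcP x y : lc x = lc y -> exists2 h, h \in H & x = y * rho (inc h).
  move=> xy; have : lc x x by exists 1; rewrite ?gpred1 // !hom1 mulg1.
  by rewrite xy.
have lcH x h : h \in H -> lc (x * rho (inc h)) = lc x.
  move=> hH; apply/seteqP; split=> y [h' h'H ->].
    by exists (h * h'); rewrite ?gpredM // !gmulfM mulgA.
  exists (h^-1 * h'); first by rewrite gpredM // gpredV.
  by rewrite !gmulfM !homV !mulgA mulgK.
(* A letter [t] met at the point [x] of [B] reads the label at [x]; a letter
   [t^-1] reads the inverse of the label at the point where it arrives. *)
pose base e x := lc (if e then x else x * (rho t)^-1).
pose step e g x := x * sgn e (rho t) * rho (inc g).
pose fix labels x l := if l is (e, g) :: l' then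
  (base e x, e) :: labels (step e g x) l' else [::] : seq (set B * bool).
have red_labels x : free_reduced (labels x l).
  elim: l x redl {l_n0} sepl => // -[e g1] [|[e' g2] l] IHl x redl sepl //.
  have /andP[red1 redl'] := redl.
  have sepl' e0 x0 : (e0, x0) \in (e', g2) :: l -> x0 \notin assoc_sub e0 ->
      separates rho e0 x0.
    by move=> xl; apply: sepl; rewrite inE xl orbT.
  rewrite /free_reduced /= in IHl *; rewrite IHl // andbT.
  apply/implyP => /eqP /lcP[h hH]; rewrite /step.
  have [->//|ne_ee'] := eqVneq e e'.
  move: red1; rewrite /= (negbTE ne_ee') /= => g1n.
  have := sepl e g1; rewrite mem_head => /(_ isT).
  move: g1n; rewrite /pinch_free /separates /=.
  case: e e' ne_ee' {redl IHl redl' sepl sepl'} => [] [] //= _ g1n /(_ g1n) sep.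
    move=> eq_x; exfalso; apply: (sep (val (phi (Subg hH)))^-1).
      by rewrite gpredV; exact: valP.
    rewrite homV -conj_t_phi homV /conjg !gmulfM homV.
    have {}eq_x : rho t * rho (inc g1) * (rho t)^-1 * rho (inc h) = 1.
      by apply: (mulgI x); rewrite mulg1 [RHS]eq_x !mulgA.
    have <- : (rho t * rho (inc g1) * (rho t)^-1)^-1 = rho (inc h) by exact: mulg1_eq.
    by rewrite !invgM !invgK !mulgA mulVg mul1g mulgVK.
  move=> eq_x; exfalso; apply: (sep h^-1); first by rewrite gpredV.
  rewrite homV homV; apply: (canRL invgK); apply: mulg1_eq.
  by apply: (mulgI (x * (rho t)^-1)); rewrite mulg1 [RHS]eq_x !mulgA.
have [V [F [CV sepV]]] := free_word_separated wrC CV0 v_neq1 (red_labels (rho (inc g))).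
pose f (x : B) : V := F (lc x).
pose base_hom : {multiplicative G -> wreath V B} :=
  wr_pair (hom_triv G V) (hom_comp rho inc).
pose tau : wreath V B := (f, rho t).
have rel_tau (h : subg H) : tau^-1 * base_hom (val h) * tau = base_hom (val (phi h)).
  rewrite -mulgA; apply: (mulgI tau); rewrite mulVKg; apply: wr_eq => [x|].
    by rewrite !wrM1 /= mul1g mulg1 /f lcH //; exact: valP.
  have E : inc (val h) * t = t * inc (val (phi h)) by rewrite -conj_t_phi -conjgC.
  rewrite -[LHS]/(rho (inc (val h)) * rho t) -[RHS]/(rho t * rho (inc (val (phi h)))).
  by rewrite -!gmulfM E.
pose sigma := hnn_lift rel_tau.
have sigma1 l' x : (sigma (hprod l')).1 x = wprod F (labels x l').
  elim: l' x => [|[e g1] l' IHl] x; first by rewrite hom1.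
  rewrite /= !gmulfM !wrM1 !wrM2 hom_sgn hnn_lift_t hnn_lift_incl /= mulg1 IHl.
  have -> : (sgn e tau).2 = sgn e (rho t) by case: (e).
  rewrite mulgA; congr (_ * _).
  by case: (e) => //=; rewrite wrV1.
exists (wreath V B), sigma; split; first exact: wrC.
move=> /(congr1 (fun u : wreath V B => u.1 1)); rewrite gmulfM wrM1.
rewrite hnn_lift_incl /= !mul1g sigma1; apply: sepV; first exact: infix_refl.
by case: (l) l_n0 => // -[].
Qed.
End HNNWords.

(** * Infinite cyclic associated subgroups *)

(** The symmetric group on an arbitrary type. *)
Section Symmetric.
Variable T : Type.

Record sym : Type := Sym {
  sym_fun : T -> T; sym_inv : T -> T;
  symK : cancel sym_fun sym_inv; symVK : cancel sym_inv sym_fun }.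

HB.instance Definition _ := gen_eqMixin sym.
HB.instance Definition _ := gen_choiceMixin sym.

Lemma sym_eq (f g : sym) : sym_fun f =1 sym_fun g -> f = g.
Proof.
case: f g => [f f' fK f'K] [g g' gK g'K] /= fg.
have efg : f = g by apply/funext.
have ef'g' : f' = g' by apply/funext => x; rewrite -[in LHS](g'K x) -fg fK.
by case: _ / efg in gK g'K fg *; case: _ / ef'g' in gK g'K *; congr Sym; exact: Prop_irrelevance.
Qed.

Definition sym_one : sym := @Sym id id (fun x => erefl x) (fun x => erefl x).
Definition sym_mul (f g : sym) : sym :=
  Sym (can_comp (symK f) (symK g)) (can_comp (symVK g) (symVK f)).
Definition sym_opp (f : sym) : sym := Sym (symVK f) (symK f).

Lemma sym_mulA : associative sym_mul. Proof. by move=> f g k; exact: sym_eq. Qed.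
Lemma sym_mul1 : left_id sym_one sym_mul. Proof. by move=> f; exact: sym_eq. Qed.
Lemma sym_mulr1 : right_id sym_one sym_mul. Proof. by move=> f; exact: sym_eq. Qed.
Lemma sym_mulV : left_inverse sym_one sym_opp sym_mul.
Proof. by move=> f; apply: sym_eq => x /=; rewrite symK. Qed.
Lemma sym_mulrV : right_inverse sym_one sym_opp sym_mul.
Proof. by move=> f; apply: sym_eq => x /=; rewrite symVK. Qed.

HB.instance Definition _ := isGroup.Build sym sym_mulA sym_mul1 sym_mulr1 sym_mulV sym_mulrV.

End Symmetric.

Definition infinite_order (G : groupType) (h : G) := forall a, zexp h a = 1 -> a = 0%R.

Lemma zexp_inj (G : groupType) (h : G) : infinite_order h -> injective (zexp h).
Proof.
move=> inf a b ab; have := inf (a - b)%R; rewrite zexpB ab mulgV => /(_ erefl).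
by move/GRing.subr0_eq.
Qed.

(** Left multiplication by an element of infinite order is free, so that choosing
    an origin in each of its orbits gives an equivariant coordinate. *)
Lemma zexp_coordinate (G : groupType) (h : G) : infinite_order h ->
  exists c : G -> int, forall a x, c (zexp h a * x) = (a + c x)%R.
Proof.
move=> inf; pose orbit x : set G := range (fun a => zexp h a * x).
pose r x := xget 1 (orbit x).
have orbitE a x : orbit (zexp h a * x) = orbit x.
  apply/seteqP; split=> _ [b _ <-].
    by exists (b + a)%R; rewrite // zexpD mulgA.
  by exists (b - a)%R; rewrite // zexpB mulgA mulgVK.
have rP x : exists a, x = zexp h a * r x.
  have [a _ ax] : orbit x (r x) by apply: (@xgetI _ _ _ x); exists 0%R; rewrite ?mul1g.
  by exists (- a)%R; rewrite -ax mulgA -zexpD GRing.addNr mul1g.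
have [c cP] := choice rP; exists c => a x; apply: (zexp_inj inf).
apply: (mulIg (r x)); rewrite zexpD -mulgA -cP.
by have := cP (zexp h a * x); rewrite /r orbitE => {2}->.
Qed.

Section Cyclic.
Variables (G : groupType) (H K : groupClosed G).
Variable phi : {multiplicative subg H -> subg K}.
Local Notation hnn := (hnn phi).
Local Notation inc := (hnn_incl phi : {multiplicative G -> hnn}).
Local Notation t := (hnn_t phi).

Record cyclic_hnn (h k : G) : Prop := CyclicHNN {
  memH : forall x, x \in H <-> exists a, x = zexp h a;
  memK : forall x, x \in K <-> exists a, x = zexp k a;
  h_inf : infinite_order h;
  k_inf : infinite_order k;
  phi_zexp : forall (x : subg H) a, val x = zexp h a -> val (phi x) = zexp k a }.

Variables (h k : G) (hk : cyclic_hnn h k).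

Lemma cyclic_phi_surj (y : subg K) : exists x, phi x = y.
Proof.
have /(memK hk)[a ya] := valP y.
have xH : zexp h a \in H by apply/(memH hk); exists a.
by exists (Subg xH); apply: val_inj; rewrite (phi_zexp hk (a := a)).
Qed.

Lemma conj_t_zexp a : inc (zexp h a) ^ t = inc (zexp k a).
Proof.
have xH : zexp h a \in H by apply/(memH hk); exists a.
by rewrite -(phi_zexp hk (x := Subg xH) (a := a)) // -conj_t_phi.
Qed.

Lemma conj_tV_zexp a : inc (zexp k a) ^ t^-1 = inc (zexp h a).
Proof. by rewrite -conj_t_zexp -conjgM mulgV conjg1. Qed.

Lemma hnn_lift_cyclic (B : groupType) (rho : {multiplicative G -> B}) tau :
    rho h * tau = tau * rho k ->
  exists sigma : {multiplicative hnn -> B},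
    (forall x, sigma (inc x) = rho x) /\ sigma t = tau.
Proof.
move=> rel; have rel_tau (x : subg H) : tau^-1 * rho (val x) * tau = rho (val (phi x)).
  have /(memH hk)[a xa] := valP x; rewrite (phi_zexp hk xa) xa !homZ.
  rewrite -mulgA -[LHS]/(zexp (rho h) a ^ tau) conj_zexp; congr (zexp _ _).
  by rewrite /conjg rel mulKg.
by exists (hnn_lift rel_tau); split=> [x|]; [exact: hnn_lift_incl|exact: hnn_lift_t].
Qed.

(** The permutations [x |-> h * x] and [x |-> k * x] of [G] need not have the
    same number of cycles, but on [G * int] both are conjugate to a translation
    of the first factor of [int * G]; this makes [h] and [k] conjugate. *)
Lemma hnn_embedding : exists (B : groupType) (rho : {multiplicative hnn -> B}),
  forall x y, rho (inc x) = rho (inc y) -> x = y.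
Proof.
pose B := sym (G * int).
have lregK (g : G) : cancel (fun u : G * int => (g * u.1, u.2)) (fun u => (g^-1 * u.1, u.2)).
  by case=> x j /=; rewrite mulKg.
have lregVK (g : G) : cancel (fun u : G * int => (g^-1 * u.1, u.2)) (fun u => (g * u.1, u.2)).
  by case=> x j /=; rewrite mulVKg.
pose lreg g : B := Sym (lregK g) (lregVK g).
have lregM : {morph lreg : x y / x * y}.
  by move=> x y; apply: sym_eq => -[z j] /=; rewrite mulgA.
have straighten (g : G) : infinite_order g ->
    exists (al : G * int -> int * G) (al' : int * G -> G * int),
    [/\ cancel al al', cancel al' al &
        forall x j, al (g * x, j) = (((al (x, j)).1 + 1)%R, (al (x, j)).2)].
  move=> g_inf; have [c cP] := zexp_coordinate g_inf.
  exists (fun u => (c u.1, zexp g (u.2 - c u.1)%R * u.1)).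
  exists (fun u => (zexp g (u.1 - c u.2)%R * u.2, c u.2)); split.
  - case=> x j /=; rewrite cP GRing.subrK mulgA -zexpD.
    by rewrite (_ : (c x - j + (j - c x))%R = 0%R) ?mul1g //; lia.
  - case=> a y /=; rewrite cP GRing.subrK mulgA -zexpD.
    by rewrite (_ : (c y - a + (a - c y))%R = 0%R) ?mul1g //; lia.
  - move=> x j /=; have := cP 1%R x; rewrite zexp1 => ->.
    have -> : (c x + 1 = 1 + c x)%R by lia.
    have -> : (j - c x = (j - (1 + c x)) + 1)%R by lia.
    by rewrite zexp_succ mulgA.
have [ah [ah' [ahK ah'K ahS]]] := straighten h (h_inf hk).
have [ak [ak' [akK ak'K akS]]] := straighten k (k_inf hk).
pose tau : B := Sym (can_comp ah'K akK) (can_comp ak'K ahK).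
have rel : lreg h * tau = tau * lreg k.
  apply: sym_eq => -[x j] /=; rewrite akS /=.
  apply: (can_inj ahK); rewrite ah'K.
  by case E : (ah' (ak (x, j))) => [y i] /=; rewrite ahS -E ah'K.
have [sigma [sigE _]] := hnn_lift_cyclic (rho := hom lregM) rel.
exists B, sigma => x y; rewrite !sigE => /(congr1 (fun s : B => (sym_fun s (1, 0%R)).1)).
by rewrite /= !mulg1.
Qed.

Lemma hnn_incl_inj : injective inc.
Proof.
have [B [rho rho_inj]] := hnn_embedding.
by move=> x y /(congr1 rho)/rho_inj.
Qed.

(** Britton's lemma is detection of reduced words for the class of all groups:
    a homomorphism injective on [G] separates everything that is to be
    separated. *)
Lemma britton g l : hnn_reduced H K l -> l <> [::] -> inc g * hprod phi l <> 1.
Proof.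
move=> redl l_n0 w1; have [B [rho rho_inj]] := hnn_embedding.
have h_neq1 : h <> 1 by move=> h1; have := h_inf hk (a := 1%R) h1.
have [e x _ xn y yin /rho_inj eq_xy|W [sigma [_]]] :=
  @reduced_detected _ _ _ phi (fun _ => True) (fun _ _ _ _ => I) G h I h_neq1 B rho g l I redl l_n0.
  by rewrite eq_xy yin in xn.
by rewrite w1 hom1.
Qed.

(** The commutator of these two elements is a reduced word with four stable
    letters. *)
Lemma britton_commute e x y : x \notin assoc_sub H K e -> y \notin assoc_sub H K (~~ e) ->
  ~ commute (inc x ^ sgn (~~ e) t) (inc y).
Proof.
move=> xn yn com; apply: (britton (g := 1) (l := [:: (e, x); (~~ e, y); (e, x^-1); (~~ e, y^-1)])) => //.
  by rewrite /hnn_reduced /= /pinch_free /assoc_sub /=; case: e xn yn com => /= xn yn _;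
    rewrite gpredV xn yn.
have ctV : sgn e t = (sgn (~~ e) t)^-1 by case: (e); rewrite /= ?invgK.
rewrite hom1 mul1g /= !mulg1 ctV; move: com; rewrite /conjg /commute !homV /=.
move: (sgn _ t) (hnn_incl phi x) (hnn_incl phi y) => s u v.
rewrite !mulgA => com.
by rewrite com -!mulgA mulVKg mulVKg mulKg mulgV.
Qed.
End Cyclic.

(** * Sections of bounded nilpotent groups *)

(** Zorn's lemma for normal subgroups between [D] and the complement of [S]. *)
Lemma maximal_avoiding (X : groupType) (D S : set X) :
    subgroup_set D -> normal_set D -> (forall x, D x -> ~ S x) ->
  exists N : set X, [/\ subgroup_set N, normal_set N, D `<=` N,
    forall x, N x -> ~ S x
    & forall N' : set X, subgroup_set N' -> normal_set N' -> N `<=` N' ->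
        (forall x, N' x -> ~ S x) -> N' `<=` N].
Proof.
move=> gD nD DS.
pose good (A : set X) := [/\ subgroup_set A, normal_set A, D `<=` A & forall x, A x -> ~ S x].
have goodD : good D by split.
(* The empty set is the union of the empty chain. *)
have [F FP Ftot|A [PA maxA]] := @Zorn_bigcup X (fun A => A = set0 \/ good A).
  have [[A0 FA0 gA0]|none] := pselect (exists2 A, F A & good A); last first.
    left; rewrite -subset0 => x [A FA Ax].
    have [A0|gA] := FP _ FA; first by rewrite -A0.
    by case: none; exists A.
  have goodF A x : F A -> A x -> good A.
    by move=> FA Ax; have [A_0|//] := FP _ FA; rewrite A_0 in Ax.
  right; split.
  - split.
    + by exists A0 => //; case: gA0 => -[].
    + move=> x y [A FA Ax] [B FB By]; have [AB|BA] := Ftot _ _ FA FB.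
        have [gB _ _ _] := goodF _ _ FB By.
        by exists B => //; apply: (sgM gB) => //; exact: AB.
      have [gA _ _ _] := goodF _ _ FA Ax.
      by exists A => //; apply: (sgM gA) => //; exact: BA.
    + move=> x [A FA Ax]; have [gA _ _ _] := goodF _ _ FA Ax.
      by exists A => //; exact: (sgV gA).
  - move=> x g [A FA Ax]; have [_ nA _ _] := goodF _ _ FA Ax.
    by exists A => //; exact: nA.
  - by move=> x Dx; exists A0 => //; case: gA0 => _ _ + _; apply.
  - by move=> x [A FA Ax]; have [_ _ _ +] := goodF _ _ FA Ax; apply.
have {PA}[A0|[gA nA DA AS]] := PA.
  case: (maxA D); last by right.
  by rewrite A0; split=> // /(_ 1 (sg1 gD)).
exists A; split=> // N' gN' nN' AN' N'S x N'x; apply: contrapT => nAx.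
by apply: (maxA N'); [split=> // /(_ x N'x)|right; split=> // y /DA /AN'].
Qed.

Section Tame.
Variables (C : group_class) (rootC : root_class C).

(** This is what a bounded nilpotent group is used for. Unlike boundedness, which
    speaks of the factors of one chosen central series, a property of all
    sections passes to subgroups and extensions without further ado. *)
Definition tame (X : groupType) :=
  forall (T Q : groupType) (i : {multiplicative T -> X}) (f : {multiplicative T -> Q}),
    injective i -> surjective_map f -> forall p, primes_of C p ->
    (exists e, forall (x : Q) j, x ^+ (p ^ j) = 1 -> x ^+ (p ^ e) = 1) /\
    ((exists e, forall x : Q, x ^+ (p ^ e) = 1) -> C Q).

Lemma tame_inj (X Y : groupType) (j : {multiplicative Y -> X}) :
  injective j -> tame X -> tame Y.
Proof.
move=> injj tX T Q i f inji surf; apply: (tX T Q (hom_comp j i) f) => //.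
by move=> x y /injj/inji.
Qed.

Lemma tame_section (X G Q : groupType) (sigma : {multiplicative G -> X})
    (f : {multiplicative G -> Q}) : tame X -> ker sigma `<=` ker f ->
    surjective_map f -> forall p, primes_of C p ->
    (exists e, forall (x : Q) j, x ^+ (p ^ j) = 1 -> x ^+ (p ^ e) = 1) /\
    ((exists e, forall x : Q, x ^+ (p ^ e) = 1) -> C Q).
Proof.
move=> tX kf surf; have nK := normal_subgroup_pred (ker_subgroup sigma) (@ker_normal _ _ sigma).
have kX x : x \in subgroup_pred (ker_subgroup sigma) -> sigma x = 1 by move/subgroup_predP.
have kQ x : x \in subgroup_pred (ker_subgroup sigma) -> f x = 1 by move/subgroup_predP/kf.
apply: (tX _ _ (quot_lift nK kX) (quot_lift nK kQ)).
  apply: hom_inj => x; rewrite -(quotg_reprK x) quot_liftE => sx.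
  exact/quotg_proj1/subgroup_predP.
by move=> q; have [x <-] := surf q; exists (quotg_proj nK x); rewrite quot_liftE.
Qed.

Lemma image_subgroup (X Y : groupType) (f : {multiplicative X -> Y}) (A : set X) :
  subgroup_set A -> subgroup_set (f @` A).
Proof.
move=> gA; split=> [|_ _ [x Ax <-] [y Ay <-]|_ [x Ax <-]].
- by exists 1; [exact: sg1 gA|exact: hom1].
- by exists (x * y); [exact: sgM gA _ _ Ax Ay|exact: gmulfM].
- by exists x^-1; [exact: sgV gA _ Ax|exact: homV].
Qed.

(** A section [Q] of an extension is an extension of a section [f T / R] of [Y]
    by a section [R] of the kernel, where [R] is the image of the part of [T]
    killed by [pi]. *)
Lemma tame_ext (X Y : groupType) (pi : {multiplicative X -> Y}) :
  tame Y -> tame (subg (subgroup_pred (ker_subgroup pi))) -> tame X.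
Proof.
move=> tY tK T Q i f inji surf p Cp.
pose s := hom_comp pi i; pose R := f @` ker s.
have gR : subgroup_set R := image_subgroup f (ker_subgroup s).
have nR : normal (subgroup_pred gR).
  apply: normal_subgroup_pred => _ g [x sx <-]; have [y <-] := surf g.
  by exists (x ^ y); [exact: ker_normal|rewrite /conjg !gmulfM homV].
have kerf : ker s `<=` ker (hom_comp (quotg_proj nR) f).
  by move=> x sx; apply/quotg_proj1/subgroup_predP; exists x.
have [|[eY expY] CY] := tame_section tY kerf _ Cp.
  by move=> q; have [x xq] := surf (quotg_repr q); exists x; rewrite /= /hom_fun xq quotg_reprK.
pose A := subgroup_pred (ker_subgroup s).
have iA (x : subg A) : i (val x) \in subgroup_pred (ker_subgroup pi).
  by apply/subgroup_predP; have /subgroup_predP := valP x.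
have fA (x : subg A) : f (val x) \in subgroup_pred gR.
  by apply/subgroup_predP; exists (val x) => //; have /subgroup_predP := valP x.
have [||[eK expK] CK] := tK _ _ (corestr (f := hom_comp i (subg_incl A)) iA)
     (corestr (f := hom_comp f (subg_incl A)) fA) _ _ _ Cp.
- by move=> x y /(congr1 val) /= /inji /val_inj.
- case=> q qR; have /subgroup_predP[x sx fx] := qR.
  have xA : x \in A by apply/subgroup_predP.
  by exists (Subg xA); apply: val_inj.
have memR (x : Q) j : quotg_proj nR x ^+ j = 1 -> x ^+ j \in subgroup_pred gR.
  by rewrite -(homX (quotg_proj nR)) => /quotg_proj1.
split=> [|[e expQ]].
  exists (eY + eK)%N => x j xj; have xR : x ^+ (p ^ eY) \in subgroup_pred gR.
    by apply: memR; apply: (expY _ j); rewrite -(homX (quotg_proj nR)) xj hom1.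
  rewrite expnD expgnA -[x ^+ _]/(val (Subg xR)) -subgX (expK _ j) //.
  by apply: val_inj; rewrite subgX /= -expgnA mulnC expgnA xj expg1n.
case: rootC => _ _ _ ext _; apply: (ext Q _ nR).
  by apply: CK; exists e => x; apply: val_inj; rewrite subgX expQ.
apply: CY; exists e => x; rewrite -(quotg_reprK x) -(homX (quotg_proj nR)) expQ.
exact: hom1.
Qed.

End Tame.

Lemma divg_mul_abelian (Q : groupType) (u w y z : Q) :
  (forall x y : Q, commute x y) -> (u * w)^-1 * (y * z) = (u^-1 * y) * (w^-1 * z).
Proof.
move=> abQ; rewrite invgM (abQ w^-1) -!mulgA; congr (_ * _).
by rewrite !mulgA (abQ y).
Qed.

Lemma divz_multiple (p : nat) (b : int) :
  (p %| `|b|)%N -> exists c : int, b = (Posz p * c)%R.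
Proof.
by move=> /dvdnP[m]; case: b => n /= bm; [exists (Posz m)|exists (- Posz m)%R]; lia.
Qed.

Section Bounded.
Variables (C : group_class) (rootC : root_class C).

Section AbelianPGroup.
Variables (p : nat) (Cp : primes_of C p).
Let p_pr : prime p := primes_of_prime Cp.

(** A maximal subgroup [N] among those missing [a] has index [p], because every
    [x] outside it satisfies [a \in <[x]> N] and hence [x \in <[a]> N]. *)
Lemma elementary_character (V Q : groupType) (v : V) (a : Q) :
    has_order v p -> (forall x y : Q, commute x y) -> (forall x : Q, x ^+ p = 1) ->
    a <> 1 -> exists chi : {multiplicative Q -> V}, chi a <> 1.
Proof.
move=> [_ vp minv] abQ Qp a1.
have g1 := trivial_subgroup Q.
have n1 : normal_set [set 1 : Q] by move=> x g ->; exact: conj1g.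
have [|N [gN nN _ aN maxN]] := maximal_avoiding (S := [set a]) g1 n1.
  by move=> x -> /esym.
have aNn b : N (zexp a b) -> (p %| `|b|)%N.
  move=> ab; apply: contrapT => /negP pb; apply: (aN a) => //.
  apply: (sg_coprime (m := p) (n := `|b|%N)) => //; first by rewrite prime_coprime.
    by rewrite Qp; exact: sg1 gN.
  by case: b ab {pb} => n //= /(sgV gN); rewrite invgK.
pose M y : set Q := [set z | exists b, N ((zexp y b)^-1 * z)].
have gM y : subgroup_set (M y).
  split=> [|z z' [b Nz] [c Nz']|z [b Nz]].
  - by exists 0%R; rewrite invg1 mul1g; exact: sg1 gN.
  - by exists (b + c)%R; rewrite zexpD divg_mul_abelian //; exact: sgM gN _ _ Nz Nz'.
  - by exists (- b)%R; have := sgV gN Nz; rewrite invgM invgK zexpN invgK abQ.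
have cover x : M a x.
  have [Nx|nNx] := pselect (N x); first by exists 0%R; rewrite invg1 mul1g.
  have nM : normal_set (M x) by move=> y g; rewrite /conjg (abQ y) mulKg.
  have NM : N `<=` M x by move=> y Ny; exists 0%R; rewrite invg1 mul1g.
  have Mx : M x x by exists 1%R; rewrite zexp1 mulVg; exact: sg1 gN.
  have [b Nb] : M x a.
    apply: contrapT => aM; apply: nNx; apply: (maxN (M x)) => // y My ya.
    by apply: aM; rewrite -ya.
  have pb : ~~ (p %| `|b|)%N.
    apply/negP => /divz_multiple[c bc]; apply: (aN a) => //; move: Nb.
    by rewrite bc zexpM zexp_nat Qp zexp1g invg1 mul1g.
  have Mb : M a (zexp x b).
    by exists 1%R; rewrite zexp1; have := sgV gN Nb; rewrite invgM invgK.
  apply: (sg_coprime (m := p) (n := `|b|%N) (gM a)).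
  - by rewrite prime_coprime.
  - by rewrite Qp; exact: sg1 (gM a).
  - by case: b Mb {Nb pb} => n //= /(sgV (gM a)); rewrite invgK.
have [c cP] := choice cover.
have ceq x y (b : int) : N ((zexp a b)^-1 * x) -> N ((zexp a y)^-1 * x) ->
    zexp v b = zexp v y.
  move=> Nb Ny; have := sgM gN Nb (sgV gN Ny).
  rewrite invgM invgK mulgA mulgK -zexpN -zexpD => /aNn /divz_multiple[d bd].
  have -> : b = (y + Posz p * (- d))%R by lia.
  by rewrite zexp_mod.
have chiM : {morph (fun x => zexp v (c x)) : x y / x * y}.
  move=> x y; rewrite -zexpD; apply: (ceq (x * y)) => //.
  by rewrite zexpD divg_mul_abelian //; exact: sgM gN _ _ (cP x) (cP y).
exists (hom chiM); rewrite /= /hom_fun (ceq a 1%R) //; last first.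
  by rewrite zexp1 mulVg; exact: sg1 gN.
by rewrite zexp1 => v1; have := minv 1%N isT v1; rewrite leqNgt prime_gt1.
Qed.

(** Distinct elements are separated by characters to a [C]-group of order [p],
    so that the group embeds into a Cartesian power indexed by itself, hence by
    any larger [C]-group. *)
Lemma root_elementary (Q Y : groupType) (j : Q -> Y) :
    (forall x y : Q, commute x y) -> (forall x : Q, x ^+ p = 1) ->
    injective j -> C Y -> C Q.
Proof.
move=> abQ Qp injj CY; have [V [v [CV ov _]]] := root_cyclic_prime rootC Cp.
have chi a : exists f : {multiplicative Q -> V}, a <> 1 -> f a <> 1.
  have [->|/eqP a1] := eqVneq a 1; first by exists (hom_triv Q V).
  by have [f fa] := elementary_character ov abQ Qp a1; exists f.
have [F FP] := choice chi.
pose J y : Q := xget 1 [set x | j x = y].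
have JK x : J (j x) = x by apply: injj; apply: (@xgetI _ _ [set z | j z = j x] x).
have fM : {morph (fun x => (fun y => F (J y) x) : cartesian (fun _ : Y => V)) :
    x x' / x * x'}.
  by move=> x x'; apply/funext => y; exact: gmulfM.
apply: (@root_inj _ rootC _ _ (hom fM)); last exact: root_power.
apply: hom_inj => x fx; apply: contrapT => x1; apply: (FP x x1).
by have := congr1 (fun g => g (j x)) fx; rewrite /= /hom_fun JK.
Qed.

(** Raising to the power [p] has an elementary abelian kernel and an image of
    smaller exponent. *)
Lemma root_abelian_pgroup e (Q Y : groupType) (j : Q -> Y) :
    (forall x y : Q, commute x y) -> (forall x : Q, x ^+ (p ^ e) = 1) ->
    injective j -> C Y -> C Q.
Proof.
elim: e Q j => [|e IHe] Q j abQ Qpe injj CY.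
  apply: (@root_inj _ rootC _ _ (hom_triv Q Y)) => // x y _.
  by rewrite -[x]expg1 -[y]expg1 -(expn0 p) !Qpe.
have powM : {morph (fun x : Q => x ^+ p) : x y / x * y}.
  by move=> x y; apply: expgMn; exact: abQ.
pose A := subgroup_pred (range_subgroup (hom powM)).
have fA x : hom powM x \in A by apply/subgroup_predP; exists x.
apply: (root_ext rootC (f := corestr fA)).
  apply: (IHe _ (fun u => j (val u))) => //.
  - by move=> x y; apply: val_inj; rewrite !valM; exact: abQ.
  - move=> x; apply: val_inj; rewrite subgX; have /subgroup_predP[y _ <-] := valP x.
    by rewrite /= /hom_fun -expgnA -expnS Qpe.
  - by move=> x y /injj /val_inj.
apply: (root_elementary (j := fun u => j (val u))) => //.
- by move=> x y; apply: val_inj; rewrite !valM; exact: abQ.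
- move=> x; apply: val_inj; rewrite subgX; have /subgroup_predP := valP x.
  by move=> /(congr1 val).
- by move=> x y /injj /val_inj.
Qed.
End AbelianPGroup.

(** A section [f T] of [A] is isomorphic to [T / ker f] and so embeds into the
    quotient of [A] by the image of [ker f], to which boundedness applies. *)
Lemma tame_bounded_abelian (A : groupType) : bounded_abelian C A -> tame C A.
Proof.
move=> [abA bA] T Q i f inji surf p Cp; have p_pr := primes_of_prime Cp.
have gN : subgroup_set (i @` ker f) := image_subgroup i (ker_subgroup f).
have nN : normal (subgroup_pred gN).
  by apply: normal_subgroup_pred => x g; rewrite /conjg (abA x) mulKg.
have [[e e_gt0 expe] [Y [CY leY]]] := bA _ nN p Cp.
have abT (x y : T) : commute x y by apply: inji; rewrite !gmulfM; exact: abA.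
have abQ (x y : Q) : commute x y.
  have [x' <-] := surf x; have [y' <-] := surf y.
  by rewrite /commute -!gmulfM abT.
have [r rK] := choice surf.
have proj_i x y : f x = f y -> quotg_proj nN (i x) = quotg_proj nN (i y).
  move=> fxy; apply/quotg_projP/subgroup_predP; exists (x^-1 * y).
    by rewrite /ker /= gmulfM homV fxy mulVg.
  by rewrite gmulfM homV.
have gM : {morph (fun q => quotg_proj nN (i (r q))) : x y / x * y}.
  by move=> x y; rewrite -!gmulfM; apply: proj_i; rewrite gmulfM !rK.
pose g := hom gM.
have injg : injective g.
  apply: hom_inj => x /quotg_proj1/subgroup_predP[y fy /inji yr].
  by rewrite -(rK x) -yr.
split.
  exists (logn p e) => x k xk.
  have xe : x ^+ e = 1.
    by apply: injg; rewrite homX hom1; apply: expe; exists k; rewrite -homX xk hom1.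
  apply: (coprime_expg1 (m := (p ^ k)%N) (n := e`_p^')).
  - by rewrite coprimeXl // prime_coprime // -p'natE // part_pnat.
  - by rewrite -expgnA mulnC expgnA xk expg1n.
  - by rewrite -expgnA -p_part partnC.
case=> e' Qe'.
have /card_leP/unsquash u := leY.
have prim q : g q \in primary_component (quotg nN) p.
  by apply/mem_set; exists e'; rewrite -homX Qe' hom1.
pose j q : Y := val (u (SigSub (prim q))).
apply: (root_abelian_pgroup Cp (e := e') (j := j)) => // x y /val_inj.
by move=> /(@inj _ _ _ u _ _ (mem_set I) (mem_set I)) /(congr1 val)/injg.
Qed.

Lemma tame_bounded_nilpotent (X : groupType) : bounded_nilpotent C X -> tame C X.
Proof.
move=> [_ [n [Z [[Z0 Zn _ _] bZ]]]].
have tZ i : (i <= n)%N -> tame C (subg (Z i)).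
  elim: i => [_|i IHi lt_in].
    have triv (x : subg (Z 0%N)) : x = 1.
      by apply: val_inj; have := valP x; rewrite Z0 inE => /eqP.
    move=> T Q j f injj surf p Cp.
    have trivQ (q : Q) : q = 1.
      have [x <-] := surf q.
      by rewrite (_ : x = 1) ?hom1 //; apply: injj; rewrite [LHS]triv [RHS]triv.
    split=> [|_]; first by exists 0%N.
    case: rootC => _ [Y [CY _]] _ _ _.
    apply: (@root_inj _ rootC _ _ (hom_triv Q Y)) => // x y _.
    by rewrite [x]trivQ [y]trivQ.
  have [nN bA] := bZ i lt_in.
  apply: (tame_ext rootC (pi := quotg_proj nN)); first exact: tame_bounded_abelian.
  have kerZ (x : subg (subgroup_pred (ker_subgroup (quotg_proj nN)))) : val (val x) \in Z i.
    by have /subgroup_predP/quotg_proj1 := valP x.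
  apply: (tame_inj (j := corestr (f := hom_comp (subg_incl _) (subg_incl _)) kerZ)).
    by move=> x y /(congr1 val) /= /val_inj/val_inj.
  exact: IHi (ltnW lt_in).
have inZ (x : X) : x \in Z n by rewrite Zn.
apply: (tame_inj (j := corestr (f := hom (fun x y : X => erefl (x * y))) inZ)).
  by move=> x y /(congr1 val).
exact: tZ.
Qed.

Lemma tame_prod (X Y : groupType) : tame C X -> tame C Y -> tame C (X * Y)%type.
Proof.
move=> tX tY; have fstM : {morph (@fst X Y) : x y / x * y} by [].
apply: (tame_ext rootC (pi := hom fstM)) => //.
have sndM : {morph (@snd X Y) : x y / x * y} by [].
apply: (tame_inj (j := hom_comp (hom sndM) (subg_incl _))) tY => u v /= eq_snd.
apply: val_inj; have /subgroup_predP u1 := valP u; have /subgroup_predP v1 := valP v.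
by apply: injective_projections => //; exact: etrans u1 (esym v1).
Qed.
End Bounded.

(** * Nilpotent groups through left-normed commutators *)

(** Nilpotency class at most [n]. As a law, it passes to subgroups, quotients
    and products at once. *)
Definition nil_class (n : nat) (X : groupType) :=
  forall (x : X) (ys : seq X), size ys = n -> foldl (@commg X) x ys = 1.

Lemma nilpotent_nil_class (X : groupType) : nilpotent_group X -> exists n, nil_class n X.
Proof.
move=> [n [Z [Z0 Zn _ cZ]]]; exists n => x ys sys.
have : x \in Z (size ys) by rewrite sys Zn.
have : (size ys <= n)%N by rewrite sys.
elim: ys x {sys} => [|y ys IHys] x /= le_sn; first by rewrite Z0 inE => /eqP.
by move=> xZ; apply: IHys; [exact: ltnW|exact: cZ].
Qed.

Lemma foldl_commg1 (X : groupType) (ys : seq X) : foldl (@commg X) 1 ys = 1.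
Proof. by elim: ys => //= y ys; rewrite comm1g. Qed.

Lemma nil_class_le (X : groupType) m n : (m <= n)%N -> nil_class m X -> nil_class n X.
Proof.
move=> le_mn nX x ys sys; rewrite -(cat_take_drop m ys) foldl_cat.
by rewrite (nX _ (take m ys)) ?foldl_commg1 // size_takel // sys.
Qed.

Lemma hom_foldl (X Y : groupType) (f : {multiplicative X -> Y}) x ys :
  f (foldl (@commg X) x ys) = foldl (@commg Y) (f x) (map f ys).
Proof. by elim: ys x => //= y ys IHys x; rewrite IHys homR. Qed.

Lemma nil_class_prod (X Y : groupType) n :
  nil_class n X -> nil_class n Y -> nil_class n (X * Y)%type.
Proof.
move=> nX nY x ys sys.
have fstM : {morph (@fst X Y) : x y / x * y} by [].
have sndM : {morph (@snd X Y) : x y / x * y} by [].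
apply: injective_projections.
  by have /= := hom_foldl (hom fstM) x ys; rewrite nX ?size_map.
by have /= := hom_foldl (hom sndM) x ys; rewrite nY ?size_map.
Qed.

Lemma nil_class_section (X G Q : groupType) (sigma : {multiplicative G -> X})
    (f : {multiplicative G -> Q}) n : ker sigma `<=` ker f -> surjective_map f ->
  nil_class n X -> nil_class n Q.
Proof.
move=> kf surf nX q qs sqs; have [r rK] := choice surf.
have -> : qs = map f (map r qs) by rewrite -map_comp map_id_in // => x _; exact: rK.
rewrite -(rK q) -hom_foldl; apply: kf; rewrite /ker /= hom_foldl nX //.
by rewrite !size_map.
Qed.

Lemma center_neq1 (Q : groupType) n (x : Q) : nil_class n Q -> x <> 1 ->
  exists c : Q, c <> 1 /\ central c.
Proof.
move=> nQ; have : forall ys, size ys = n -> foldl (@commg Q) x ys = 1 by move=> ys; exact: nQ.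
elim: n x {nQ} => [|n IHn] x nx x1; first by case: x1; exact: (nx [::]).
have [cx|] := pselect (central x); first by exists x.
move/existsNP => [y /commgP/eqP xy]; apply: (IHn [~ x, y]) => // ys sys.
by apply: (nx (y :: ys)); rewrite /= sys.
Qed.

Lemma center_subgroup (Q : groupType) : subgroup_set [set x : Q | central x].
Proof.
split=> [y|x y cx cy z|x cx z] /=; first by rewrite /commute mul1g mulg1.
  by apply/commute_sym/commuteM; apply/commute_sym.
by apply/commute_sym/commuteV/commute_sym.
Qed.

Lemma center_normal (Q : groupType) : normal_set [set x : Q | central x].
Proof. by move=> x g cx /=; rewrite /conjg cx mulKg. Qed.

Lemma commgX_central (Q : groupType) (x y : Q) m :
  central [~ x, y] -> [~ x ^+ m, y] = [~ x, y] ^+ m.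
Proof.
move=> cxy; rewrite commgEl conjXg; have -> : x ^ y = x * [~ x, y].
  by rewrite commgEl mulVKg.
by rewrite expgMn ?mulKg //; apply/commute_sym/cxy.
Qed.

(** If [x] is central modulo the center, then [x ^+ E] commutes with [y] as
    soon as [E] kills the central element [[~ x, y]]: so an exponent of the
    center is an exponent of every factor of the upper central series. *)
Lemma exponent_of_center (Q : groupType) n E : nil_class n Q ->
  (forall c : Q, central c -> c ^+ E = 1) -> forall x : Q, x ^+ (E ^ n) = 1.
Proof.
elim: n Q => [|n IHn] Q nQ cE x; first exact: (nQ _ [::]).
have nZ := normal_subgroup_pred (center_subgroup Q) (@center_normal Q).
pose pr : {multiplicative Q -> quotg nZ} := quotg_proj nZ.
have prc y : pr y = 1 <-> central y.
  by split=> [/quotg_proj1/subgroup_predP|cy]; last exact/quotg_proj1/subgroup_predP.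
have prS q : exists y, pr y = q by exists (quotg_repr q); exact: quotg_reprK.
have nQZ : nil_class n (quotg nZ).
  move=> q qs sqs; have [y yq] := prS q; have [r rK] := choice prS.
  have -> : qs = map pr (map r qs) by rewrite -map_comp map_id_in // => z _; exact: rK.
  rewrite -yq -(hom_foldl pr); apply/prc => z; apply/commgP/eqP.
  have := nQ y (rcons (map r qs) z); rewrite -cats1 foldl_cat /=; apply.
  by rewrite size_cat size_map sqs addn1.
have cEZ (q : quotg nZ) : central q -> q ^+ E = 1.
  have [y <-] := prS q => cy; rewrite -(homX pr); apply/prc => z; apply/commgP/eqP.
  have cyz : central [~ y, z].
    by apply/prc; rewrite (homR pr); apply/eqP/commgP/cy.
  by rewrite commgX_central // cE.
have := IHn _ nQZ cEZ (pr x); rewrite -(homX pr) => /prc /cE.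
by rewrite -expgnA expnSr.
Qed.

(** * Separation by quotients of prime power exponent *)

Definition class_primes (C : group_class) : nat_pred := [pred q | `[< primes_of C q >]].

Lemma class_primesP (C : group_class) q : reflect (primes_of C q) (q \in class_primes C).
Proof. exact: asboolP. Qed.

Section Separation.
Variables (C : group_class) (rootC : root_class C).
Hypothesis periodicC : forall X : groupType, C X -> periodic X.
Local Notation pi := (class_primes C).

Lemma primes_of_nonempty : exists p, primes_of C p.
Proof.
case: rootC => _ [X [CX [x x1]]] _ _ _.
have [N N_gt0 xN] := periodicC CX x; have [n on] := order_exists N_gt0 xN.
have n_gt1 : (1 < n)%N.
  by case: on => n_gt0 xn _; case: n xn n_gt0 => [|[|n]] // /x1.
exists (pdiv n); apply: (prime_order_mem CX on); [exact: pdiv_prime|exact: pdiv_dvd].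
Qed.

Lemma pi'nat_coprime p m : primes_of C p -> pi^'.-nat m -> coprime p m.
Proof.
move=> Cp pim; rewrite prime_coprime ?(primes_of_prime Cp) //; apply/negP => pm.
have /andP[_ /allP] := pim; have m_gt0 : (0 < m)%N by case/andP: pim.
move=> /(_ p); rewrite mem_primes (primes_of_prime Cp) m_gt0 pm => /(_ isT).
by rewrite !inE => /negP; apply; apply/asboolP.
Qed.

(** [N] is a maximal normal subgroup containing [D] but no power of [g] with
    exponent prime to [pi]. Then every nontrivial central subgroup of [G / N]
    contains such a power; this leaves room for a single prime [p], and the
    center is a [p]-group. Its exponent is finite because [G / N] is a section
    of [X], and it bounds the exponent of [G / N]. *)
Lemma separating_pquotient (X G : groupType) (sigma : {multiplicative G -> X}) n
    (D : set G) (g : G) : tame C X -> nil_class n X ->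
    subgroup_set D -> normal_set D -> ker sigma `<=` D ->
    (forall m, pi^'.-nat m -> ~ D (g ^+ m)) ->
  exists (N : set G) (p : nat), [/\ primes_of C p, subgroup_set N /\ normal_set N,
    D `<=` N, ~ N g & exists e, forall x, N (x ^+ (p ^ e))].
Proof.
move=> tX nX gD nD kD gmD.
have [|N [gN nN DN NS maxN]] := maximal_avoiding (S := [set g ^+ m | m in [set m | pi^'.-nat m]]) gD nD.
  by move=> x Dx [m pim gmx]; apply: (gmD m pim); rewrite gmx.
have nNp := normal_subgroup_pred gN nN.
pose pr : {multiplicative G -> quotg nNp} := quotg_proj nNp.
have pr1 x : pr x = 1 <-> N x.
  by split=> [/quotg_proj1/subgroup_predP|Nx]; last exact/quotg_proj1/subgroup_predP.
have prS q : exists y, pr y = q by exists (quotg_repr q); exact: quotg_reprK.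
have kpr : ker sigma `<=` ker pr by move=> x /kD /DN /pr1.
have nQ : nil_class n (quotg nNp) := nil_class_section kpr prS nX.
set a := pr g.
have am m : pi^'.-nat m -> a ^+ m <> 1.
  by move=> pim; rewrite -homX => /pr1 /NS; apply; exists m.
have catch (c : quotg nNp) : central c -> c <> 1 ->
    exists2 m, pi^'.-nat m & exists j, a ^+ m = zexp c j.
  move=> cc c1; apply: contrapT => none; have [x xc] := prS c.
  pose N' : set G := [set y | cyclic_set c (pr y)].
  have gc := cyclic_subgroup_set c.
  have /pr1 : N x; last by rewrite xc.
  apply: (maxN N').
  - split=> [|y z|y]; rewrite /N' /= ?hom1 ?gmulfM ?homV; first exact: sg1 gc.
      exact: sgM gc _ _.
    exact: sgV gc _.
  - move=> y z [j _ jy]; exists j => //.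
    rewrite /conjg !gmulfM homV -jy; apply: (canRL (mulKg _)).
    exact/commute_sym/commute_sym/commute_zexp/commute_sym/cc.
  - by move=> y /pr1 y1; rewrite /N' /= y1; exact: sg1 gc.
  - move=> y [j _ jy] [m pim gmy]; apply: none; exists m => //; exists j.
    by rewrite jy -gmy homX.
  - by exists 1%R; rewrite ?zexp1.
have a1 : a <> 1 by have := am 1%N isT.
have [c0 [c01 cc0]] := center_neq1 nQ a1.
have [m pim [j0 amj]] := catch c0 cc0 c01.
have central_zexp (c : quotg nNp) j : central c -> central (zexp c j).
  by move=> cc; apply: (sg_zexp j (center_subgroup _)) cc.
have cu : central (a ^+ m) by rewrite amj; exact: central_zexp.
have [o oa] : exists o, has_order a o.
  have [p0 Cp0] := primes_of_nonempty.
  have p0_gt0 := prime_gt0 (primes_of_prime Cp0).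
  have m_gt0 : (0 < m)%N by case/andP: pim.
  have [u1|u1] := eqVneq (a ^+ m ^+ p0) 1.
    by apply: (order_exists (N := (m * p0)%N)); rewrite ?muln_gt0 ?m_gt0 // expgnA.
  have [|m' pim' [j amj']] := catch (a ^+ m ^+ p0) _ (elimN eqP u1).
    exact: (central_zexp _ (Posz p0)).
  have : zexp a (Posz m' - Posz m * Posz p0 * j)%R = 1.
    by rewrite zexpB !zexpM !zexp_nat -amj' mulgV.
  move=> /zexp_abs1; apply: order_exists; rewrite absz_gt0; apply/eqP => mj.
  have := pi'nat_coprime Cp0 pim'; rewrite prime_coprime ?(primes_of_prime Cp0) //.
  move/negP; apply; apply/dvdnP.
  have mj' : (Posz m' = Posz m * Posz p0 * j)%R by lia.
  exists (m * `|j|)%N; have := congr1 absz mj'; rewrite !abszM /= => ->; lia.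
have [o_gt0 ao _] := oa.
pose o' := (o`_pi^')%N.
have pio' : pi^'.-nat (m * o')%N by rewrite pnatM pim part_pnat.
pose w := a ^+ (m * o').
have w1 : w <> 1 := am _ pio'.
have wpi : w ^+ (o`_pi)%N = 1.
  by rewrite /w -expgnA -mulnA (mulnC o') partnC // mulnC expgnA ao expg1n.
have [ow oww] := order_exists (part_gt0 _ _) wpi.
have ow_gt1 : (1 < ow)%N.
  by case: oww => ow_gt0 wow _; case: ow wow ow_gt0 => [|[|ow]] // /w1.
pose p := pdiv ow.
have p_pr : prime p := pdiv_prime ow_gt1.
have Cp : primes_of C p.
  have /(pnatP _ (part_gt0 _ _)) o_pi := part_pnat pi o; apply/class_primesP/o_pi => //.
  exact: dvdn_trans (pdiv_dvd _) (order_dvd oww wpi).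
have := has_order_div oww (pdiv_dvd ow); rewrite -/p.
set z := w ^+ _ => oz; have [_ zp minz] := oz.
have z1 : z <> 1 by move=> z1; have := minz 1%N isT z1; rewrite leqNgt prime_gt1.
pose M := (m * o' * (ow %/ p))%N.
have zM : z = a ^+ M by rewrite /z /w -expgnA.
have zin (c : quotg nNp) : central c -> c <> 1 -> exists j, z = zexp c j.
  move=> cc c1; have [mc pimc [j amc]] := catch c cc c1.
  have [|||j' _ <-] := @sg_coprime _ (cyclic_set c) z p mc (cyclic_subgroup_set c); last by exists j'.
  - exact: pi'nat_coprime.
  - by rewrite zp; exact: sg1 (cyclic_subgroup_set c).
  - rewrite zM expgnAC amc -zexp_nat -zexpM; by exists (j * Posz M)%R.
have ctor (c : quotg nNp) : central c -> exists k, c ^+ (p ^ k) = 1.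
  move=> cc; have [->|/eqP c1] := eqVneq c 1; first by exists 0%N.
  have [j zj] := zin c cc c1.
  have [oc occ] : exists oc, has_order c oc.
    have : zexp c (j * Posz p)%R = 1 by rewrite zexpM -zj.
    move=> /zexp_abs1; apply: order_exists; rewrite absz_gt0; apply/eqP.
    have j_neq0 : j <> 0%R by move=> j_eq0; rewrite j_eq0 in zj.
    have := prime_gt0 p_pr; nia.
  exists (logn p oc); rewrite -p_part; apply: contrapT => c'1.
  have [oc_gt0 coc _] := occ.
  have [|j' zj'] := zin _ _ c'1; first exact: (central_zexp c (Posz _)).
  apply: z1; apply: (coprime_expg1 (m := p) (n := (oc`_p^')%N)) => //.
    by rewrite prime_coprime // -p'natE // part_pnat.
  rewrite zj' -zexp_nat -zexpM GRing.mulrC zexpM zexp_nat -expgnA partnC // coc.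
  exact: zexp1g.
have [[e expQ] _] := tame_section tX kpr prS Cp.
exists N, p; split=> //; first by move/pr1/a1.
exists (e * n)%N => x; apply/pr1; rewrite homX expnM.
apply: exponent_of_center => // c cc.
by have [k ck] := ctor c cc; apply: expQ ck.
Qed.
End Separation.

(** * Quotients of the HNN-extension with prescribed characters *)

Definition zexp2 (M : groupType) (x y : M) (a b : int) : M := zexp x a * zexp y b.

Lemma zexp2_0 (M : groupType) (x y : M) : zexp2 x y 0%R 0%R = 1.
Proof. exact: mulg1. Qed.

Lemma zexp2D (M : groupType) (x y : M) a b a' b' : commute x y ->
  zexp2 x y (a + a')%R (b + b')%R = zexp2 x y a b * zexp2 x y a' b'.
Proof.
move=> xy; rewrite /zexp2 !zexpD -!mulgA; congr (_ * _); rewrite !mulgA; congr (_ * _).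
exact/commute_zexp/commute_sym/commute_zexp/commute_sym.
Qed.

Lemma zexp2N (M : groupType) (x y : M) a b : commute x y ->
  zexp2 x y (- a)%R (- b)%R = (zexp2 x y a b)^-1.
Proof.
by move=> xy; apply/esym/mulg1_eq; rewrite -zexp2D // !GRing.subrr zexp2_0.
Qed.

Lemma zexp2M (M : groupType) (x y : M) a b n : commute x y ->
  zexp2 x y (a * n)%R (b * n)%R = zexp (zexp2 x y a b) n.
Proof.
move=> xy; rewrite /zexp2 zexpMg -?zexpM //.
exact/commute_zexp/commute_sym/commute_zexp/commute_sym.
Qed.

Lemma zexp2_central (M : groupType) (x y : M) a b :
  central x -> central y -> central (zexp2 x y a b).
Proof.
move=> cx cy; apply: (sgM (center_subgroup M)).
  exact: (sg_zexp a (center_subgroup M)).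
exact: (sg_zexp b (center_subgroup M)).
Qed.

Section Characters.
Variables (C : group_class) (rootC : root_class C).
Hypothesis periodicC : forall X : groupType, C X -> periodic X.
Variables (G : groupType) (H K : groupClosed G).
Variable phi : {multiplicative subg H -> subg K}.
Local Notation hnn := (hnn phi).
Local Notation inc := (hnn_incl phi : {multiplicative G -> hnn}).
Local Notation t := (hnn_t phi).
Variables (h k : G) (hk : cyclic_hnn phi h k).
Hypotheses (h_central : central h) (k_central : central k).

Local Notation hkz := (zexp2 h k).

Let hkz_central a b : central (hkz a b).
Proof. exact: zexp2_central. Qed.

Let hkC : commute h k := h_central k.

Variables (X : groupType) (n : nat) (sigma : {multiplicative G -> X}).
Hypotheses (tX : tame C X) (nX : nil_class n X).
Hypothesis sigma_inj : forall a b, sigma (hkz a b) = 1 -> hkz a b = 1.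

Variables (p : nat) (Cp : primes_of C p) (s : nat).
Variables (M L : groupType) (CM : C M) (CL : C L) (lam : L) (c : L -> M).
Hypotheses (abM : forall x y : M, commute x y) (Mps : forall x : M, x ^+ (p ^ s) = 1).

(** The characters [h |-> c i], [k |-> c (i / lam)] of the central subgroup
    generated by [h] and [k], indexed by [i]: multiplying the index by [lam]
    exchanges the roles of [h] and [k]. *)
Definition chr i : int -> int -> M := zexp2 (c i) (c (i / lam)).

Hypothesis chr_rel : forall a b, hkz a b = 1 -> forall i, chr i a b = 1.

Let p_pr : prime p := primes_of_prime Cp.

Lemma chrD i a b a' b' : chr i (a + a')%R (b + b')%R = chr i a b * chr i a' b'.
Proof. exact: zexp2D. Qed.

Lemma chrN i a b : chr i (- a)%R (- b)%R = (chr i a b)^-1.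
Proof. exact: zexp2N. Qed.

Let hkzD a b a' b' : hkz (a + a')%R (b + b')%R = hkz a b * hkz a' b'.
Proof. exact: zexp2D. Qed.

Let hkzN a b : hkz (- a)%R (- b)%R = (hkz a b)^-1.
Proof. exact: zexp2N. Qed.

Lemma chr_eq a b a' b' : sigma (hkz a b) = sigma (hkz a' b') ->
  forall i, chr i a b = chr i a' b'.
Proof.
move=> eq_s i; apply: divg1_eq; rewrite -chrN -chrD; apply: chr_rel.
by apply: sigma_inj; rewrite hkzD hkzN gmulfM homV eq_s mulgV.
Qed.

(** The common kernel of the characters, saturated by the kernel of [sigma]. *)
Definition chr_ker : set G :=
  [set x | exists a b, sigma x = sigma (hkz a b) /\ forall i, chr i a b = 1].

Lemma chr_ker_subgroup : subgroup_set chr_ker.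
Proof.
split=> [|x y [a [b [xab cab]]] [a' [b' [xab' cab']]]|x [a [b [xab cab]]]].
- by exists 0%R, 0%R; split=> [|i]; rewrite ?/chr zexp2_0.
- exists (a + a')%R, (b + b')%R; split=> [|i].
    by rewrite hkzD [LHS]gmulfM [RHS]gmulfM xab xab'.
  by rewrite chrD cab cab' mulg1.
- exists (- a)%R, (- b)%R; split=> [|i]; first by rewrite hkzN !homV xab.
  by rewrite chrN cab invg1.
Qed.

Lemma chr_ker_normal : normal_set chr_ker.
Proof.
move=> x g [a [b [xab cab]]]; exists a, b; split=> //.
by rewrite /conjg [LHS]gmulfM [X in _ * X = _]gmulfM homV xab (gmulf_commute sigma (hkz_central a b g)) mulKg.
Qed.

Let zps a b : chr_ker (hkz a b ^+ (p ^ s)).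
Proof.
exists (a * Posz (p ^ s))%R, (b * Posz (p ^ s))%R; split=> [|i].
  by rewrite -zexp_nat -zexp2M.
by rewrite /chr zexp2M ?zexp_nat ?Mps.
Qed.

(** One element of [hkz a b] after the other is kept out of the kernel. The prime
    that [separating_pquotient] provides must be [p], since [hkz a b] has
    [p]-power order modulo the kernel of the characters. *)
Lemma chr_avoid (zs : seq (int * int)) : exists N : set G,
  [/\ subgroup_set N, normal_set N, chr_ker `<=` N,
      exists e, forall x, N (x ^+ (p ^ e))
    & forall a b, (a, b) \in zs -> N (hkz a b) -> forall i, chr i a b = 1].
Proof.
elim: zs => [|[a b] zs [N [gN nN kN [e eN] zN]]].
  by exists setT; split=> //; exists 0%N.
have [triv|] := pselect (forall i, chr i a b = 1).
  exists N; split=> //; first by exists e.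
  by move=> a' b'; rewrite inE => /orP[/eqP[-> ->]|/zN].
move=> /existsNP[i chri].
have kersig : ker sigma `<=` chr_ker.
  move=> x x1; exists 0%R, 0%R; split=> [|j]; rewrite ?/chr zexp2_0 //.
  by rewrite hom1.
have [|N' [p' [Cp' [gN' nN'] kN' zN' [e' eN']]]] := separating_pquotient (g := hkz a b)
    rootC periodicC tX nX chr_ker_subgroup chr_ker_normal kersig.
  move=> m pim [a' [b' [zab cab]]]; apply: chri.
  apply: (coprime_expg1 (m := (p ^ s)%N) (n := m)) => //.
    by apply: coprimeXl; exact: pi'nat_coprime pim.
  have := chr_eq (a := (a * Posz m)%R) (b := (b * Posz m)%R) (a' := a') (b' := b').
  rewrite zexp2M // zexp_nat zab => /(_ erefl i).
  by rewrite /chr zexp2M // zexp_nat => ->; exact: cab.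
have eq_pp' : p' = p.
  apply: contrapT => /eqP ne_pp'; apply: zN'.
  apply: (sg_coprime (m := (p' ^ e')%N) (n := (p ^ s)%N) gN') => //.
    by rewrite coprimeXl // coprimeXr // prime_coprime ?(primes_of_prime Cp') // dvdn_prime2 ?(primes_of_prime Cp').
  exact/kN'/zps.
rewrite {}eq_pp' in eN'.
exists (N `&` N'); split.
- split=> [|x y [Nx N'x] [Ny N'y]|x [Nx N'x]].
  + by split; [exact: sg1 gN|exact: sg1 gN'].
  + by split; [exact: (sgM gN)|exact: (sgM gN')].
  + by split; [exact: (sgV gN)|exact: (sgV gN')].
- by move=> x g [Nx N'x]; split; [exact: nN|exact: nN'].
- by move=> x kx; split; [exact: kN|exact: kN'].
- exists (e + e')%N => x; split.
    by rewrite expnD expgnA -zexp_nat; apply: (sg_zexp _ gN).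
  by rewrite addnC expnD expgnA -zexp_nat; apply: (sg_zexp _ gN').
- move=> a' b'; rewrite inE => /orP[/eqP[-> ->] [_ /zN']//|in_zs [Nz _]].
  exact: zN.
Qed.

(** The characters have exponent [p ^ s], so that finitely many [hkz a b] represent
    all of them modulo their common kernel. *)
Lemma chr_subgroup : exists N : set G,
  [/\ subgroup_set N, normal_set N, chr_ker `<=` N,
      exists e, forall x, N (x ^+ (p ^ e))
    & forall a b, N (hkz a b) -> forall i, chr i a b = 1].
Proof.
have ps_gt0 : (0 < p ^ s)%N by rewrite expn_gt0 prime_gt0.
have [N [gN nN kN eN zN]] := chr_avoid
  [seq (Posz i, Posz j) | i <- iota 0 (p ^ s), j <- iota 0 (p ^ s)].
exists N; split=> // a b Nz.
have [i [q [lt_i ua]]] := int_euclid a ps_gt0; have [j [q' [lt_j ub]]] := int_euclid b ps_gt0.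
have kq : chr_ker (hkz (q * Posz (p ^ s)) (q' * Posz (p ^ s)))%R.
  by rewrite zexp2M // zexp_nat; exact: zps.
have Nij : N (hkz (Posz i) (Posz j)).
  have := sgM gN Nz (sgV gN (kN _ kq)).
  by rewrite ua ub hkzD -mulgA mulgV mulg1.
have cq l : chr l (q * Posz (p ^ s))%R (q' * Posz (p ^ s))%R = 1.
  by rewrite /chr zexp2M // zexp_nat Mps.
move=> l; rewrite ua ub chrD cq mulg1; apply: zN Nij l.
by apply: allpairs_f; rewrite mem_iota.
Qed.

(** Extend the characters to a normal subgroup [Y] of [G] with [G / Y] in the
    class and induce them to [G]: for a transversal [r] this is the monomial
    homomorphism sending [x] to the function
    [(q, i) |-> chr i (r q * x * (r (q * x))^-1)] followed by [x] itself. As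
    [h] and [k] are central, they become functions of [i] alone, and the
    translation of [i] by [lam] conjugates one to the other. *)
Lemma character_hnn : exists (B : groupType) (rho : {multiplicative hnn -> B}),
  C B /\ forall a b, rho (inc (hkz a b)) = 1 -> forall i, chr i a b = 1.
Proof.
have [N [gN nN kN [e eN] zN]] := chr_subgroup.
have Ndiv z z' x y : central z' -> N (z^-1 * x) -> N (z'^-1 * y) ->
    N ((z * z')^-1 * (x * y)).
  move=> cz' Nx Ny; have cV : central z'^-1 := sgV (center_subgroup G) cz'.
  by rewrite invgM -mulgA (cV _) -!mulgA -(cV y) mulgA; exact: sgM gN _ _ Nx Ny.
have NdivV z x : central z -> N (z^-1 * x) -> N (z^-1^-1 * x^-1).
  by move=> cz Nx; have := sgV gN Nx; rewrite invgM invgK (cz x^-1).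
have Nquot z w x : central w -> N (z^-1 * x) -> N (w^-1 * x) -> N (w / z).
  move=> cw Nz Nw; have := sgM gN Nz (sgV gN Nw).
  by rewrite invgM invgK mulgA mulgK (cw z^-1).
pose Y : set G := [set x | exists ab : int * int, N ((hkz ab.1 ab.2)^-1 * x)].
have hkzY a b : Y (hkz a b) by exists (a, b); rewrite mulVg; exact: sg1 gN.
have gY : subgroup_set Y.
  split=> [|x y [[a b] /= Nx] [[a' b'] /= Ny]|x [[a b] /= Nx]].
  - by have := hkzY 0%R 0%R; rewrite zexp2_0.
  - exists ((a + a')%R, (b + b')%R) => /=; rewrite hkzD.
    by apply: Ndiv => //; exact: hkz_central.
  - exists ((- a)%R, (- b)%R) => /=; rewrite hkzN.
    by apply: NdivV => //; exact: hkz_central.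
have nY : normal_set Y.
  move=> x g [[a b] /= Nx]; exists (a, b) => /=.
  have cV : central (hkz a b)^-1 := sgV (center_subgroup G) (hkz_central a b).
  have -> : (hkz a b)^-1 * x ^ g = ((hkz a b)^-1 * x) ^ g; last exact: nN.
  by rewrite conjMg; congr (_ * _); rewrite /conjg cV mulKg.
pose S := quotg (normal_subgroup_pred gY nY).
pose be : {multiplicative G -> S} := quotg_proj (normal_subgroup_pred gY nY).
have be1 x : be x = 1 <-> Y x.
  by split=> [/quotg_proj1/subgroup_predP|Yx]; last exact/quotg_proj1/subgroup_predP.
pose r : S -> G := @quotg_repr _ _ _.
have rK q : be (r q) = q by exact: quotg_reprK.
have CS : C S.
  have kbe : ker sigma `<=` ker be.
    move=> x x1; apply/be1; exists (0%R, 0%R); rewrite /= zexp2_0 invg1 mul1g.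
    apply: kN; exists 0%R, 0%R; split=> [|i]; rewrite ?/chr zexp2_0 //.
    by rewrite hom1.
  have beS : surjective_map be by move=> q; exists (r q).
  have [_ CS] := tame_section tX kbe beS Cp.
  apply: CS; exists e => q; rewrite -(rK q) -homX; apply/be1; exists (0%R, 0%R).
  by rewrite /= zexp2_0 invg1 mul1g.
(* The characters extend from the [hkz a b] to [Y] by being trivial on [N],
   because they vanish at every [hkz a b] in [N]. *)
have coords x : exists ab : int * int, Y x -> N ((hkz ab.1 ab.2)^-1 * x).
  by have [[ab Nab]|nYx] := pselect (Y x); [exists ab|exists (0%R, 0%R)].
have [co coP] := choice coords.
pose ext i x := chr i (co x).1 (co x).2.
have extE i a b x : N ((hkz a b)^-1 * x) -> ext i x = chr i a b.
  move=> Nx; have Yx : Y x by exists (a, b).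
  apply: divg1_eq; rewrite -chrN -chrD; apply: zN; rewrite hkzD hkzN.
  exact: Nquot (hkz_central _ _) Nx (coP x Yx).
have extM i x y : Y x -> Y y -> ext i (x * y) = ext i x * ext i y.
  move=> Yx Yy; rewrite /ext -chrD; apply: extE; rewrite hkzD.
  by apply: Ndiv; [exact: hkz_central|exact: coP|exact: coP].
pose u q x := r q * x * (r (q * be x))^-1.
have uY q x : Y (u q x).
  by apply/be1; rewrite /u !gmulfM homV !rK mulgV.
have uM q x y : u q (x * y) = u q x * u (q * be x) y.
  by rewrite /u gmulfM !mulgA mulgVK.
pose ind x : wreath M (S * L)%type := (fun qi => ext qi.2 (u qi.1 x), (be x, 1)).
have indM : {morph ind : x y / x * y}.
  move=> x y; apply: wr_eq => [[q i]|]; last by rewrite wrM2 /= gmulfM; congr pair; rewrite mulg1.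
  by rewrite wrM1 /= uM extM // mulg1.
have u_central q x : Y x -> central x -> u q x = x.
  move=> Yx cx; have /be1 bx := Yx.
  by rewrite /u bx mulg1 -(cx (r q)) mulgK.
have ind_hkz a b q i : (ind (hkz a b)).1 (q, i) = chr i a b.
  rewrite /= (u_central q _ (hkzY a b) (hkz_central a b)).
  by apply: extE; rewrite mulVg; exact: sg1 gN.
pose tau : wreath M (S * L)%type := (fun=> 1, (1, lam)).
have zh : h = hkz 1%R 0%R by rewrite /zexp2 mulg1.
have zk : k = hkz 0%R 1%R by rewrite /zexp2 mul1g.
have be_h : be h = 1 by rewrite zh; apply/be1.
have be_k : be k = 1 by rewrite zk; apply/be1.
have ind_h q i : (ind h).1 (q, i) = c i by rewrite zh ind_hkz /chr /zexp2 mulg1.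
have ind_k q i : (ind k).1 (q, i) = c (i / lam) by rewrite zk ind_hkz /chr /zexp2 mul1g.
have rel : ind h * tau = tau * ind k.
  apply: wr_eq => [[q i]|]; last by rewrite !wrM2 /= be_h be_k; congr pair; rewrite mul1g mulg1.
  rewrite !wrM1 mulg1 mul1g ind_h.
  by rewrite [in RHS](_ : (q, i) * tau.2 = (q * 1, i * lam)) // ind_k mulgK.
have [rho [rhoE _]] := hnn_lift_cyclic hk (rho := hom indM) rel.
exists (wreath M (S * L)%type), rho; split.
  by apply: (root_wreath rootC) => //; exact: root_prod.
move=> a b; rewrite rhoE => z1 i; rewrite -(ind_hkz a b 1 i).
by have -> : ind (hkz a b) = 1.
Qed.
End Characters.

(** * Families of characters *)

Section Choices.
Variables (C : group_class) (rootC : root_class C).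
Hypothesis periodicC : forall X : groupType, C X -> periodic X.
Variables (G : groupType) (H K : groupClosed G).
Variable phi : {multiplicative subg H -> subg K}.
Local Notation hnn := (hnn phi).
Local Notation inc := (hnn_incl phi : {multiplicative G -> hnn}).
Variables (h k : G) (hk : cyclic_hnn phi h k).
Hypotheses (h_central : central h) (k_central : central k).
Variables (X : groupType) (n : nat) (sigma : {multiplicative G -> X}).
Hypotheses (tX : tame C X) (nX : nil_class n X).
Local Notation hkz := (zexp2 h k).
Hypothesis sigma_inj : forall a b, sigma (hkz a b) = 1 -> hkz a b = 1.

Definition detected (P : int -> int -> Prop) :=
  exists (B : groupType) (rho : {multiplicative hnn -> B}),
    C B /\ forall a b, rho (inc (hkz a b)) = 1 -> P a b.

Lemma detected_imp (P Q : int -> int -> Prop) :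
  (forall a b, P a b -> Q a b) -> detected P -> detected Q.
Proof. by move=> PQ [B [rho [CB rhoP]]]; exists B, rho; split=> // a b /rhoP/PQ. Qed.

Section OnePrime.
Variables (p : nat) (Cp : primes_of C p).
Let p_pr : prime p := primes_of_prime Cp.

Lemma detected_chr (s : nat) (M L : groupType) (l : M) (lam : L) (c : L -> M) :
    C M -> C L -> has_order l (p ^ s) -> (forall x, exists a, x = zexp l a) ->
    (forall a b, hkz a b = 1 -> forall i, chr lam c i a b = 1) ->
  detected (fun a b => forall i, chr lam c i a b = 1).
Proof.
move=> CM CL [_ ls _] cyc.
exact: (character_hnn rootC periodicC hk h_central k_central tX nX sigma_inj Cp CM CL
  (cyclic_commute cyc) (cyclic_exponent ls cyc)).
Qed.

(** When [H] meets [K] trivially the characters may be chosen freely: the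
    support of [c] is a single point. *)
Lemma detected_free s : (forall a b, hkz a b = 1 -> a = 0%R /\ b = 0%R) ->
  detected (fun a b => (p ^ s.+1 %| `|a|)%N /\ (p ^ s.+1 %| `|b|)%N).
Proof.
move=> free; have [M [l [CM ol cyc]]] := root_cyclic_ppower rootC Cp s.+1.
have l1 : l <> 1.
  move=> l1; have [_ _ /(_ 1%N isT)] := ol; rewrite l1 expg1n leqNgt => /(_ erefl).
  by rewrite -{1}(expn0 p) ltn_exp2l // prime_gt1.
pose c (i : M) := if i == 1 then l else 1.
apply: detected_imp (detected_chr (c := c) (lam := l) CM CM ol cyc _) => [a b|a b /free[-> ->] i].
  move=> chr1; split; apply: (order_dvdz ol).
    have := chr1 1; rewrite /chr /zexp2 /c eqxx mul1g invg_eq1.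
    by rewrite ifN; [rewrite zexp1g mulg1|apply/eqP].
  have := chr1 l; rewrite /chr /zexp2 /c mulgV eqxx.
  by rewrite ifN; [rewrite zexp1g mul1g|apply/eqP].
by rewrite /chr /zexp2 !zexp0 mulg1.
Qed.

Variable m : nat.

(** If [h ^+ m = k ^+ m] then [c i / c (i / lam)] has to be killed by [m]; the
    identity of a cyclic group with generator [lam] is such a choice. *)
Lemma detected_plus s : (p ^ s %| m)%N ->
    (forall a b, hkz a b = 1 -> exists j, a = (Posz m * j)%R /\ b = (- (Posz m * j))%R) ->
  detected (fun a b => (p ^ s %| `|a|)%N /\ (p ^ s %| `|b|)%N).
Proof.
move=> ps_m rel; have [M [l [CM ol cyc]]] := root_cyclic_ppower rootC Cp s.
have [_ ls _] := ol; have abM := cyclic_commute cyc.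
apply: detected_imp (detected_chr (c := id) (lam := l) CM CM ol cyc _) => [a b|a b].
  move=> chr1; split; apply: (order_dvdz ol).
    by have := chr1 l; rewrite /chr /zexp2 mulgV zexp1g mulg1.
  have := chr1 1; rewrite /chr /zexp2 zexp1g !mul1g zexpV => /eqP.
  by rewrite invg_eq1 => /eqP.
move=> /rel[j [-> ->]] i; rewrite /chr /zexp2 zexpN -zexpV -zexpMg; last exact: abM.
rewrite invgM invgK (abM l) mulVKg zexpM zexp_nat.
by have /dvdnP[q ->] := ps_m; rewrite mulnC expgnA ls expg1n zexp1g.
Qed.

(** With constant characters [h] is detected in spite of [h ^+ m = k ^+ m]. *)
Lemma detected_plus_h s :
    (forall a b, hkz a b = 1 -> exists j, a = (Posz m * j)%R /\ b = (- (Posz m * j))%R) ->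
  detected (fun a b => b = 0%R -> (p ^ s %| `|a|)%N).
Proof.
move=> rel; have [M [l [CM ol cyc]]] := root_cyclic_ppower rootC Cp s.
apply: detected_imp (detected_chr (c := fun=> l) (lam := 1 : M) CM CM ol cyc _) => [a b|a b].
  by move=> /(_ 1) + b0; rewrite /chr /zexp2 b0 mulg1; exact: order_dvdz.
by move=> /rel[j [-> ->]] i; rewrite /chr /zexp2 zexpN mulgV.
Qed.

Section Minus.
Hypothesis C2 : primes_of C 2.

(** A cyclic group of order two supplies a sign that changes at every step. *)
Lemma sign_group : exists (E : groupType) (v : E),
  C E /\ forall x : E, (x / v == 1) = (x != 1).
Proof.
have [E [v [CE ov cyc]]] := root_cyclic_ppower rootC C2 1.
exists E, v; split=> // x; have [a xa] := cyc x; have [_ vv minv] := ov.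
have v1 : v <> 1 by move=> v1; have := minv 1%N isT v1.
have [a2 [j aj]] : exists a2 : bool, exists j, a = (Posz a2 + Posz 2 * j)%R.
  exists (odd `|a|); case: (a) => i /=.
    by exists (Posz i./2); have := odd_double_half i; lia.
  by exists (- Posz i.+1./2 - Posz (odd i.+1))%R; have := odd_double_half i.+1; lia.
rewrite xa aj zexp_mod //; case: (a2) => /=.
  by rewrite expg1 mulgV eqxx; apply/esym/eqP.
by rewrite expg0 mul1g invg_eq1 eqxx; apply/eqP.
Qed.

(** If [h ^+ m = k ^- m] then [c i * c (i / lam)] has to be killed by [m]; an
    alternating sign reduces this to [detected_plus]. *)
Lemma detected_minus s : (p ^ s %| m)%N ->
    (forall a b, hkz a b = 1 -> exists j, a = (Posz m * j)%R /\ b = (Posz m * j)%R) ->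
  detected (fun a b => (p ^ s %| `|a|)%N /\ (p ^ s %| `|b|)%N).
Proof.
move=> ps_m rel; have [M [l [CM ol cyc]]] := root_cyclic_ppower rootC Cp s.
have [E [v [CE signE]]] := sign_group.
have [_ ls _] := ol; have abM := cyclic_commute cyc.
pose c (i : M * E) : M := if i.2 == 1 then i.1 else i.1^-1.
have c_div i x : c ((i, x) / (l, v)) = if x == 1 then (i / l)^-1 else i / l.
  by rewrite /c /= signE; case: eqP.
apply: detected_imp (detected_chr (c := c) (lam := (l, v) : (M * E)%type) CM _ ol cyc _) => [a b||a b].
- move=> chr1; split; apply: (order_dvdz ol).
    have := chr1 (l, v); rewrite /chr /zexp2 c_div /c /=.
    have -> : (v == 1) = false.
      by apply/negbTE; rewrite -signE mulgV eqxx.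
    rewrite mulgV zexp1g mulg1 zexpV => /eqP.
    by rewrite invg_eq1 => /eqP.
  by have := chr1 (1, 1); rewrite /chr /zexp2 c_div /c /= eqxx zexp1g !mul1g invgK.
- exact: root_prod.
move=> /rel[j [-> ->]] [i x]; rewrite /chr /zexp2 -zexpMg; last exact: abM.
rewrite c_div /c /=; have lm : l ^+ m = 1.
  by have /dvdnP[q ->] := ps_m; rewrite mulnC expgnA ls expg1n.
case: eqP => _; first by rewrite invgM invgK (abM l) mulVKg zexpM zexp_nat lm zexp1g.
by rewrite mulKg zexpV zexpM zexp_nat lm zexp1g invg1.
Qed.

Lemma detected_minus_h s :
    (forall a b, hkz a b = 1 -> exists j, a = (Posz m * j)%R /\ b = (Posz m * j)%R) ->
  detected (fun a b => b = 0%R -> (p ^ s %| `|a|)%N).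
Proof.
move=> rel; have [M [l [CM ol cyc]]] := root_cyclic_ppower rootC Cp s.
have [E [v [CE signE]]] := sign_group; have abM := cyclic_commute cyc.
pose c (x : E) : M := if x == 1 then l else l^-1.
apply: detected_imp (detected_chr (c := c) (lam := v) CM CE ol cyc _) => [a b|a b].
  by move=> /(_ 1) + b0; rewrite /chr /zexp2 b0 mulg1 /c eqxx; exact: order_dvdz.
move=> /rel[j [-> ->]] x; rewrite /chr /zexp2 -zexpMg; last exact: abM.
by rewrite /c signE; case: eqP => _ /=; rewrite ?mulgV ?mulVg zexp1g.
Qed.
End Minus.
End OnePrime.
End Choices.

(** * The intersection of the associated subgroups *)

Lemma zexp_period (X : groupType) (A : set X) (x : X) : subgroup_set A ->
  (exists2 a, a <> 0%R & A (zexp x a)) ->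
  exists2 m : nat, (0 < m)%N & forall a, A (zexp x a) <-> (m %| `|a|)%N.
Proof.
move=> gA [a a0 Aa].
have absA b : A (zexp x b) <-> A (x ^+ `|b|%N).
  case: b => b //=; split=> [/(sgV gA)|/(sgV gA)//]; by rewrite invgK.
have ex : exists i, (0 < i)%N && `[< A (x ^+ i) >].
  by exists `|a|%N; rewrite absz_gt0; apply/andP; split; [exact/eqP|exact/asboolP/absA].
case: (ex_minnP ex) => m /andP[m_gt0 /asboolP Am] minm; exists m => // b.
split=> [/absA Ab|/divz_multiple[c ->]]; last first.
  by rewrite zexpM; exact: (sg_zexp c gA Am).
rewrite /dvdn -leqn0 leqNgt; apply/negP => r_gt0.
have := ltn_pmod `|b| m_gt0; rewrite ltnNge minm // r_gt0 /=; apply/asboolP.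
have -> : x ^+ (`|b| %% m) = x ^+ `|b|%N * (zexp (x ^+ m) (Posz (`|b| %/ m)))^-1.
  apply: (canRL (mulgK _)).
  by rewrite zexp_nat -expgnA -expgnDr mulnC addnC -divn_eq.
by apply: (sgM gA) => //; apply: (sgV gA); exact: sg_zexp.
Qed.

Lemma cosets_card (G : groupType) (A L : groupClosed G) (D : {pred G}) (x : G) m :
    (0 < m)%N -> (forall y, (y \in D) = (y \in A) && (y \in L)) ->
    (forall y, y \in A <-> exists a, y = zexp x a) ->
    (forall a, zexp x a \in L <-> (m %| `|a|)%N) ->
  (cosets A D #= `I_m)%card.
Proof.
move=> m_gt0 inD memA memL.
pose cs (y : G) : set G := [set y * l | l in [set l | l \in D]].
have memAL a : zexp x a \in D <-> (m %| `|a|)%N.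
  by rewrite inD; split=> [/andP[_ /memL]//|/memL ->]; rewrite andbT; apply/memA; exists a.
have csE y l : l \in D -> cs (y * l) = cs y.
  rewrite inD => /andP[lA lL]; apply/seteqP; split=> _ [l' /= l'AL <-].
    exists (l * l'); rewrite ?mulgA //=; move: l'AL; rewrite !inD => /andP[l'A l'L].
    by rewrite !gpredM.
  exists (l^-1 * l'); last by rewrite -mulgA mulVKg.
  by rewrite /=; move: l'AL; rewrite !inD => /andP[l'A l'L]; rewrite !gpredM ?gpredV.
have -> : cosets A D = (fun i : nat => cs (x ^+ i)) @` `I_m.
  apply/seteqP; split=> [_ [y /= /memA[a ya] <-]|_ [i /= _ <-]]; last first.
    by exists (x ^+ i) => //=; apply/memA; exists (Posz i).
  rewrite {}ya.
  have [i [q [lt_i ->]]] := int_euclid a m_gt0.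
  exists i => //=; rewrite -zexp_nat -(csE _ (zexp x (q * Posz m)%R)) -?zexpD //.
  by apply/memAL; rewrite abszM dvdn_mull.
apply: inj_card_eq => i j /set_mem /= lt_i /set_mem /= lt_j eq_ij.
have : cs (x ^+ i) (x ^+ i) by exists 1; rewrite ?mulg1 //= inD !gpred1.
rewrite eq_ij => -[l /= lAL xl].
have : zexp x (Posz i - Posz j)%R \in D.
  have <- : l = zexp x (Posz i - Posz j)%R; last by [].
  apply: (mulgI (x ^+ j)); rewrite xl -!zexp_nat -zexpD; congr zexp; lia.
move=> /memAL dvd_ij; have [|ij_gt0] := posnP `|Posz i - Posz j|%N; first by lia.
by have := dvdn_leq ij_gt0 dvd_ij; lia.
Qed.

Lemma cosets_card_infinite (G : groupType) (A L : groupClosed G) (D : {pred G}) (x : G) :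
    (forall y, (y \in D) = (y \in A) && (y \in L)) ->
    (forall y, y \in A <-> exists a, y = zexp x a) ->
    (forall a, zexp x a \in L -> a = 0%R) ->
  (cosets A D #= [set: int])%card.
Proof.
move=> inD memA memL; pose cs (y : G) : set G := [set y * l | l in [set l | l \in D]].
have -> : cosets A D = (fun a => cs (zexp x a)) @` [set: int].
  apply/seteqP; split=> [_ [y /= /memA[a ya] <-]|_ [a _ <-]].
    by exists a; rewrite // ya.
  by exists (zexp x a) => //=; apply/memA; exists a.
apply: inj_card_eq => a b _ _ /= eq_ab.
have : cs (zexp x a) (zexp x a) by exists 1; rewrite ?mulg1 //= inD !gpred1.
rewrite eq_ab => -[l /=]; rewrite inD => /andP[_ lL] xl.
have : zexp x (a - b)%R \in L.
  have <- : l = zexp x (a - b)%R; last by [].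
  by apply: (mulgI (zexp x b)); rewrite xl -zexpD; congr zexp; lia.
by move/memL; lia.
Qed.

Section Intersection.
Variables (G : groupType) (H K : groupClosed G).
Variable phi : {multiplicative subg H -> subg K}.
Variables (h k : G) (hk : cyclic_hnn phi h k).
Hypotheses (h_central : central h) (k_central : central k).
Local Notation hkz := (zexp2 h k).

Lemma zexp_memH a : zexp h a \in H. Proof. by apply/(memH hk); exists a. Qed.
Lemma zexp_memK a : zexp k a \in K. Proof. by apply/(memK hk); exists a. Qed.

Lemma hkz_memH a b : (hkz a b \in H) = (zexp k b \in H).
Proof. by rewrite gpredMl // zexp_memH. Qed.
Lemma hkz_memK a b : (hkz a b \in K) = (zexp h a \in K).
Proof. by rewrite gpredMr // zexp_memK. Qed.

Lemma hkz_eq1 a b : hkz a b = 1 -> zexp h a = zexp k (- b)%R.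
Proof. by move=> /mulg1_eq zab; rewrite zexpN -zab invgK. Qed.

(** In a nontrivial relation between [h] and [k] both exponents are nonzero,
    because both orders are infinite, so that each of [H] and [K] contains a
    nontrivial power of the generator of the other. *)
Lemma intersection_cases :
  (forall a b, hkz a b = 1 -> a = 0%R /\ b = 0%R) \/
  exists m n : nat, [/\ (0 < m)%N, (0 < n)%N,
    forall a, zexp h a \in K <-> (m %| `|a|)%N &
    forall b, zexp k b \in H <-> (n %| `|b|)%N].
Proof.
have [|/existsNP[a /existsNP[b /not_implyP[zab ab0]]]] :=
  pselect (forall a b, hkz a b = 1 -> a = 0%R /\ b = 0%R); first by left.
have hakb := hkz_eq1 zab.
have a0 : a <> 0%R.
  move=> a0; apply: ab0; split=> //; have := k_inf hk (a := (- b)%R).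
  by rewrite -hakb a0 => /(_ erefl); lia.
have b0 : (- b)%R <> 0%R.
  by move=> b0; apply: a0; apply: (h_inf hk); rewrite hakb b0.
have [m m_gt0 mP] := zexp_period (groupClosed_set K) (x := h) (ex_intro2 _ _ a a0
  (eq_ind_r (fun y => y \in K) (zexp_memK _) hakb)).
have [n n_gt0 nP] := zexp_period (groupClosed_set H) (x := k) (ex_intro2 _ _ (- b)%R b0
  (eq_ind (zexp h a) (fun y => y \in H) (zexp_memH _) _ hakb)).
by right; exists m, n.
Qed.

Section Related.
Variables (m n : nat).
Hypothesis (mP : forall a, zexp h a \in K <-> (m %| `|a|)%N).

(** Both [h ^+ m] and [k ^+ n] generate the intersection of [H] and [K], which is
    infinite cyclic and so has only two generators, inverse to each other. *)
Lemma related_generators : (0 < m)%N ->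
    (forall b, zexp k b \in H <-> (n %| `|b|)%N) ->
  exists e : bool, h ^+ m = zexp k (if e then Posz n else - Posz n)%R.
Proof.
move=> m_gt0 nP; have /(memK hk)[b hb] : zexp h (Posz m) \in K by exact/mP.
have /(memH hk)[a ka] : zexp k (Posz n) \in H by exact/nP.
have /divz_multiple[u bu] : (n %| `|b|)%N by apply/nP; rewrite -hb zexp_memH.
have /divz_multiple[w aw] : (m %| `|a|)%N by apply/mP; rewrite -ka zexp_memK.
have : (Posz m * (w * u) = Posz m)%R.
  apply: (zexp_inj (h_inf hk)); rewrite GRing.mulrA zexpM -aw -ka -zexpM -bu.
  by rewrite -hb.
move=> wu; have {}wu : (w * u = 1)%R by nia.
have [u1|u1] : (u = 1)%R \/ (u = -1)%R.
  have : (`|w| * `|u| = 1)%N by rewrite -abszM wu.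
  by move/eqP; rewrite muln_eq1 => /andP[_ /eqP]; lia.
- by exists true; rewrite -zexp_nat hb bu u1 GRing.mulr1.
- by exists false; rewrite -zexp_nat hb bu u1 GRing.mulrN1.
Qed.

Lemma related_relations (e : bool) :
    h ^+ m = zexp k (if e then Posz n else - Posz n)%R ->
  forall a b, hkz a b = 1 -> exists j,
    a = (Posz m * j)%R /\ b = (if e then - (Posz n * j) else Posz n * j)%R.
Proof.
move=> hm a b /hkz_eq1 zab.
have /divz_multiple[j aj] : (m %| `|a|)%N by apply/mP; rewrite zab zexp_memK.
exists j; split=> //.
have /(zexp_inj (k_inf hk)) : zexp k (- b)%R = zexp k ((if e then Posz n else - Posz n) * j)%R.
  by rewrite -zab aj !zexpM -hm.
by case: e {hm} => jb; nia.
Qed.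
End Related.
End Intersection.

(** * Sufficiency *)

Lemma isolated_pi'nat (C : group_class) (G : groupType) (Y : {pred G}) :
  isolated (primes_of' C) Y ->
  forall m x, (class_primes C)^'.-nat m -> x ^+ m \in Y -> x \in Y.
Proof.
move=> isoY m x; have [n] := ubnP m; elim: n m x => // n IHn m x lt_mn pim.
have [le_m1|m_gt1] := leqP m 1.
  by have /andP[m_gt0 _] := pim; have -> : m = 1%N by lia.
have p_pr := pdiv_prime m_gt1.
have pm := pdiv_dvd m.
rewrite -(divnK pm) expgnA => xm.
have mp_gt0 : (0 < m %/ pdiv m)%N by rewrite divn_gt0 ?prime_gt0 // dvdn_leq // ltnW.
apply: (IHn (m %/ pdiv m)%N).
- by have := ltn_Pdiv (prime_gt1 p_pr) (ltnW m_gt1); lia.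
- by apply: pnat_dvd pim; exact: dvdn_div.
apply: isoY xm; split=> // Cp.
have := pi'nat_coprime Cp pim; rewrite prime_coprime // => /negP; exact.
Qed.

Lemma ndvd_pexp p (a : int) : prime p -> a <> 0%R -> ~ (p ^ `|a|.+1 %| `|a|)%N.
Proof.
move=> p_pr a0 /dvdn_leq; rewrite absz_gt0 => /(_ (introN eqP a0)).
have := ltn_expl `|a| (prime_gt1 p_pr); have := leq_pexp2l (prime_gt0 p_pr) (leqnSn `|a|); lia.
Qed.

Lemma ndvd_part m a : (0 < m)%N -> ~ (m %| a)%N ->
  exists p, [/\ prime p, (p %| m)%N & exists s, (p ^ s %| m)%N /\ ~ (p ^ s %| a)%N].
Proof.
move=> m_gt0 /negP ma; apply: contrapT => none; move/negP: ma; apply.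
apply/(dvdn_partP _ m_gt0) => p; rewrite mem_primes => /and3P[p_pr _ pm].
apply: contrapT => pa; apply: none; exists p; split=> //.
by exists (logn p m); rewrite -p_part dvdn_part.
Qed.

Section Sufficiency.
Variables (C : group_class) (rootC : root_class C).
Hypothesis periodicC : forall X : groupType, C X -> periodic X.
Variables (G : groupType) (H K : groupClosed G).
Variable phi : {multiplicative subg H -> subg K}.
Local Notation hnn := (hnn phi).
Local Notation inc := (hnn_incl phi : {multiplicative G -> hnn}).
Local Notation t := (hnn_t phi).
Variables (h k : G) (hk : cyclic_hnn phi h k).
Hypotheses (h_central : central h) (k_central : central k).
Local Notation hkz := (zexp2 h k).
Variables (X : groupType) (sigma : {multiplicative G -> X}).
Hypothesis BNX : BN C X.
Hypothesis G_residual : residually (BN C) G.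
Hypothesis sigma_inj : forall a b, sigma (hkz a b) = 1 -> hkz a b = 1.
Hypotheses (isoH : isolated (primes_of' C) H) (isoK : isolated (primes_of' C) K).
Hypothesis same_index :
  (cosets H [predI H & K] #= cosets K [predI H & K])%card.
Hypothesis two : primes_of C 2 \/
  (forall x : G, x \in [predI H & K] -> central (inc x)).

Let tX : tame C X := tame_bounded_nilpotent rootC (proj2 BNX).
Let nilX : exists n, nil_class n X.
Proof. by case: BNX => _ [+ _] => /nilpotent_nil_class. Qed.

(** The powers [h^a] and [k^b] that lie outside the other subgroup are told
    apart from it by the residues of [a] and [b] modulo some prime power. *)
Lemma detected_residues :
  (forall e a b, hkz a b \notin assoc_sub H K e ->
     exists d, detected C phi h k (fun a b => (d %| `|a|)%N /\ (d %| `|b|)%N) /\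
       ~ (d %| `|if e then a else b|)%N) /\
  (forall a, a <> 0%R -> exists d,
     detected C phi h k (fun a b => b = 0%R -> (d %| `|a|)%N) /\ ~ (d %| `|a|)%N).
Proof.
have [n nX] := nilX; have [p0 Cp0] := primes_of_nonempty rootC periodicC.
have p0_pr := primes_of_prime Cp0.
have [free|[m [m' [m_gt0 m'_gt0 mP mP']]]] := intersection_cases hk.
  have det s := detected_free rootC periodicC hk h_central k_central tX nX sigma_inj Cp0 s free.
  split=> [e a b z_out|a a0]; last first.
    exists (p0 ^ `|a|.+1)%N; split; last exact: ndvd_pexp.
    by apply: detected_imp (det `|a|%N) => a1 b1 [dvd1 _] _.
  exists (p0 ^ `|if e then a else b|.+1)%N; split=> //; apply: ndvd_pexp => // c0.
  move/negP: z_out; apply; case: e c0 => /= c0.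
    by rewrite (hkz_memK hk) c0 zexp0 gpred1.
  by rewrite (hkz_memH hk) c0 zexp0 gpred1.
have eq_mm' : m' = m.
  apply/card_eq_II.
  have cH := cosets_card (D := [predI H & K]) m_gt0 (fun y => erefl) (memH hk) mP.
  have cK := cosets_card (D := [predI H & K]) m'_gt0 (fun y => andbC _ _) (memK hk) mP'.
  apply: card_eq_trans cH; apply: card_eq_trans (card_esym same_index).
  exact: card_esym.
rewrite {}eq_mm' in mP' m'_gt0.
have [e0 hm] := related_generators hk mP m_gt0 mP'.
have rel := related_relations hk mP hm.
have mprimes p : prime p -> (p %| m)%N -> primes_of C p.
  move=> p_pr pm; apply: contrapT => nCp.
  pose q : int := (Posz (m %/ p))%N.
  have mq : (q * Posz p = Posz m)%R by rewrite /q -PoszM divnK.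
  have : hkz q (if e0 then - q else q)%R \in H.
    apply: (isoH (q := p)); first by split.
    rewrite -zexp_nat -zexp2M; last exact: h_central.
    rewrite /zexp2 mq zexp_nat hm -zexpD (_ : (_ + _)%R = 0%R) ?gpred1 //.
    by case: (e0); lia.
  rewrite (hkz_memH hk) => /mP' dvd_m.
  have q_gt0 : (0 < m %/ p)%N by rewrite divn_gt0 ?prime_gt0 // dvdn_leq.
  have := @dvdn_leq m (m %/ p) q_gt0; have := ltn_Pdiv (prime_gt1 p_pr) m_gt0.
  have -> : (m %| m %/ p)%N by move: dvd_m; case: (e0); rewrite ?abszN.
  by lia.
have C2 : e0 = false -> primes_of C 2.
  move=> e0F; case: two => // cen; exfalso.
  have hmK : h ^+ m \in K by rewrite hm (zexp_memK hk).
  have hmHK : h ^+ m \in [predI H & K] by rewrite inE (zexp_memH hk (Posz m)) hmK.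
  have := conj_t_zexp hk (Posz m).
  rewrite /conjg (cen _ hmHK t) mulKg => /(hnn_incl_inj hk).
  by rewrite zexp_nat hm e0F => eq_k; have := zexp_inj (k_inf hk) (eq_k : _ = zexp k (Posz m)); lia.
have det p s : primes_of C p -> (p ^ s %| m)%N ->
    detected C phi h k (fun a b => (p ^ s %| `|a|)%N /\ (p ^ s %| `|b|)%N).
  move=> Cp ps_m; case: e0 {hm mprimes} rel C2 => rel C2.
    exact: (detected_plus rootC periodicC hk h_central k_central tX nX sigma_inj Cp ps_m rel).
  exact: (detected_minus rootC periodicC hk h_central k_central tX nX sigma_inj Cp (C2 erefl) ps_m rel).
have det_h p s : primes_of C p ->
    detected C phi h k (fun a b => b = 0%R -> (p ^ s %| `|a|)%N).
  move=> Cp; case: e0 {hm mprimes} rel C2 => rel C2.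
    exact: (detected_plus_h rootC periodicC hk h_central k_central tX nX sigma_inj Cp s rel).
  exact: (detected_minus_h rootC periodicC hk h_central k_central tX nX sigma_inj Cp (C2 erefl) s rel).
split=> [e a b z_out|a a0]; last first.
  by exists (p0 ^ `|a|.+1)%N; split; [exact: det_h|exact: ndvd_pexp].
have ndvd : ~ (m %| `|if e then a else b|)%N.
  move=> dvd; move/negP: z_out; apply; case: e dvd => /= dvd.
    by rewrite (hkz_memK hk); exact/mP.
  by rewrite (hkz_memH hk); exact/mP'.
have [p [p_pr pm [s [ps_m ps_n]]]] := ndvd_part m_gt0 ndvd.
by exists (p ^ s)%N; split=> //; apply: det => //; exact: mprimes.
Qed.

Lemma assoc_central e x : x \in assoc_sub H K e -> central x.
Proof.
case: e => /=; [move/(memK hk)|move/(memH hk)] => -[a ->].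
  exact: (sg_zexp a (center_subgroup G)).
exact: (sg_zexp a (center_subgroup G)).
Qed.

Lemma assoc_hkz e x : x \in assoc_sub H K e -> exists c d, x = hkz c d /\
  if e then c = 0%R else d = 0%R.
Proof.
case: e => /= [/(memK hk)|/(memH hk)] [c ->]; [exists 0%R, c|exists c, 0%R];
by rewrite /hkz ?mulg1 ?mul1g.
Qed.

Lemma hkz_separated e a b : hkz a b \notin assoc_sub H K e ->
  exists (B : groupType) (rho : {multiplicative hnn -> B}), C B /\ separates rho e (hkz a b).
Proof.
move=> z_out; have [d [[B [rho [CB rhoP]]] ndvd]] := proj1 detected_residues e a b z_out.
exists B, rho; split=> // x /assoc_hkz[c [c' [-> c0]]] eq_z; apply: ndvd.
have [|da db] := rhoP (a - c)%R (b - c')%R.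
  rewrite zexp2D // zexp2N //; move: (hkz a b) (hkz c c') eq_z => z z' eq_z.
  by rewrite !gmulfM !homV eq_z mulgV.
by case: e c0 {z_out} => /= c0; move: da db; rewrite c0 GRing.subr0.
Qed.

Let hkz_central a b : central (hkz a b).
Proof. exact: zexp2_central. Qed.

Lemma hkz_inj a b a' b' : sigma (hkz a b) = sigma (hkz a' b') -> hkz a b = hkz a' b'.
Proof.
move=> eq_s; apply: divg1_eq; rewrite -zexp2N // -zexp2D //; apply: sigma_inj.
by rewrite zexp2D // zexp2N // gmulfM homV eq_s mulgV.
Qed.

(** If a power of [g] with exponent prime to [pi] is a product [hkz a b], then it
    is outside the isolated subgroup as well and may take the place of [g]. *)
Lemma outside_separated e g : g \notin assoc_sub H K e ->
  exists (B : groupType) (rho : {multiplicative hnn -> B}), C B /\ separates rho e g.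
Proof.
move=> g_out; set A := assoc_sub H K e.
have isoA : isolated (primes_of' C) A by rewrite /A; case: (e).
have [[m [pim [a [b gm]]]]|none] := pselect (exists m, (class_primes C)^'.-nat m /\
    exists a b, g ^+ m = hkz a b).
  have z_out : hkz a b \notin A.
    by rewrite -gm; apply: contra g_out; exact: (isolated_pi'nat isoA pim).
  have [B [rho [CB sep]]] := hkz_separated z_out; exists B, rho; split=> // x xA eq_gx.
  apply: (sep (x ^+ m)); first exact: gpredXn.
  by rewrite -gm !homX eq_gx.
(* Otherwise some bounded nilpotent image of [G] separates the powers of [g]
   from the associated subgroups, and a quotient in which both of these vanish
   separates [g] from them. *)
have [Y [tau [n [tY nY sepY]]]] : exists (Y : groupType) (tau : {multiplicative G -> Y}) n,
    [/\ tame C Y, nil_class n Y & forall m a b, (class_primes C)^'.-nat m ->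
        tau (g ^+ m) <> tau (hkz a b)].
  have [n nX] := nilX.
  have [[m [pim [a [b gm]]]]|none1] := pselect (exists m, (class_primes C)^'.-nat m /\
    exists a b, sigma (g ^+ m) = sigma (hkz a b)); last first.
    by exists X, sigma, n; split=> // m a b pim eq_m; apply: none1; exists m; split=> //; exists a, b.
  pose y := g ^+ m / hkz a b.
  have y1 : y <> 1 by move=> /divg1_eq gmz; apply: none; exists m; split=> //; exists a, b.
  have [X1 [sigma1 [[tf1 bn1] _ y11]]] := G_residual y1.
  have [n1 nX1] := nilpotent_nil_class (proj1 bn1).
  have pairM : {morph (fun x => (sigma x, sigma1 x)) : x x' / x * x'}.
    by move=> x x'; rewrite !gmulfM.
  exists (X * X1)%type, (hom pairM), (maxn n n1); split.
  - exact: (tame_prod rootC tX (tame_bounded_nilpotent rootC bn1)).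
  - by apply: nil_class_prod; [apply: nil_class_le nX|apply: nil_class_le nX1]; lia.
  move=> m' a' b' pim' [eq0 eq1]; apply: y11.
  apply/eqP; apply: (isolated_pi'nat (Y := pred1 1) tf1 pim').
  have powz (c d : int) (i : nat) : hkz c d ^+ i = hkz (c * Posz i)%R (d * Posz i)%R.
    by rewrite zexp2M.
  have eq_z : hkz a b ^+ m' = hkz a' b' ^+ m.
    rewrite !powz; apply: hkz_inj; rewrite -!powz !homX.
    by rewrite -gm -eq0 !homX expgnAC.
  rewrite inE /y -homX expgnFl; last exact/commute_sym/hkz_central.
  rewrite eq_z expgnAC gmulfM homV [sigma1 (g ^+ m' ^+ m)]homX.
  by rewrite [sigma1 (_ ^+ m)]homX eq1 mulgV eqxx.
pose D : set G := [set x | exists a b, tau x = tau (hkz a b)].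
have gD : subgroup_set D.
  split=> [|x x' [a [b xz]] [a' [b' xz']]|x [a [b xz]]].
  - by exists 0%R, 0%R; rewrite zexp2_0.
  - by exists (a + a')%R, (b + b')%R; rewrite zexp2D // [LHS]gmulfM [RHS]gmulfM xz xz'.
  - by exists (- a)%R, (- b)%R; rewrite zexp2N // !homV xz.
have nD : normal_set D.
  move=> x u [a [b xz]]; exists a, b; rewrite -xz /conjg !gmulfM homV xz.
  by rewrite (gmulf_commute tau (hkz_central a b u)) mulKg.
have kD : ker tau `<=` D.
  by move=> x x1; exists 0%R, 0%R; rewrite zexp2_0 hom1.
have gD' m : (class_primes C)^'.-nat m -> ~ D (g ^+ m).
  by move=> pim [a [b eq_m]]; exact: (sepY m a b pim).
have [N [p [Cp [gN nN] DN Ng [e' eN]]]] :=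
  separating_pquotient rootC periodicC tY nY gD nD kD gD'.
have nNp := normal_subgroup_pred gN nN.
pose pr : {multiplicative G -> quotg nNp} := quotg_proj nNp.
have pr1 x : pr x = 1 <-> N x.
  by split=> [/quotg_proj1/subgroup_predP|Nx]; last exact/quotg_proj1/subgroup_predP.
have prS : surjective_map pr by move=> q; exists (quotg_repr q); exact: quotg_reprK.
have kpr : ker tau `<=` ker pr by move=> x /kD /DN /pr1.
have [_ CQ] := tame_section tY kpr prS Cp.
have pr_z a b : pr (hkz a b) = 1 by apply/pr1/DN; exists a, b.
have rel : pr h * 1 = 1 * pr k.
  have := pr_z 1%R 0%R; have := pr_z 0%R 1%R.
  by rewrite /zexp2 mul1g !zexp1 mulg1 => -> ->.
have [rho [rhoE _]] := hnn_lift_cyclic hk rel.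
exists (quotg nNp), rho; split.
  by apply: CQ; exists e' => q; have [x <-] := prS q; rewrite -homX; apply/pr1.
move=> x /assoc_hkz[c [c' [-> _]]]; rewrite !rhoE pr_z => /pr1; exact: Ng.
Qed.

Lemma separated_family (l : seq (bool * G)) :
  exists (B : groupType) (rho : {multiplicative hnn -> B}), C B /\
    forall e x, (e, x) \in l -> x \notin assoc_sub H K e -> separates rho e x.
Proof.
elim: l => [|[e x] l [B [rho [CB sep]]]].
  by case: rootC => _ [B [CB _]] _ _ _; exists B, (hom_triv hnn B).
have [x_in|x_out] := boolP (x \in assoc_sub H K e).
  exists B, rho; split=> // e' x'; rewrite inE => /orP[/eqP[-> ->]|/sep//].
  by rewrite x_in.
have [B' [rho' [CB' sep']]] := outside_separated x_out.
exists (wreath B B'), (wr_pair rho rho'); split; first exact: (root_wreath rootC).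
move=> e' x'; rewrite inE => /orP[/eqP[-> ->] _ y yA|x'l x'_out y yA] [eq1 eq2].
  exact: (sep' y yA).
exact: (sep e' x' x'l x'_out y yA (congr1 (fun f => f 1) eq1)).
Qed.

Lemma base_detected g : g <> 1 ->
  exists (B : groupType) (rho : {multiplicative hnn -> B}), C B /\ rho (inc g) <> 1.
Proof.
move=> g1; have [gH|g_out] := boolP (g \in H); last first.
  have [B [rho [CB sep]]] := @outside_separated false g g_out.
  exists B, rho; split=> // rho1; apply: (sep 1); first exact: gpred1.
  by rewrite rho1 !hom1.
have /(memH hk)[a ga] := gH.
have a0 : a <> 0%R by move=> a0; apply: g1; rewrite ga a0.
have [d [[B [rho [CB rhoP]]] ndvd]] := proj2 detected_residues a a0.
exists B, rho; split=> // rho1; apply: ndvd; apply: (rhoP a 0%R) => //.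
by rewrite /zexp2 mulg1 -ga.
Qed.

Lemma hnn_residually : residually C hnn.
Proof.
move=> w w1; suff [B [rho [CB rho_w]]] : exists (B : groupType)
    (rho : {multiplicative hnn -> B}), C B /\ rho w <> 1.
  exact: residually_hom rho_w.
have [g [l [redl wE]]] := hnn_reduced_form (cyclic_phi_surj hk) w.
rewrite wE in w1 *.
have [l0|l_n0] := eqVneq l [::].
  rewrite l0 /= mulg1 in w1 *; apply: base_detected => g1; apply: w1.
  by rewrite g1 hom1.
have [B [rho [CB sep]]] := separated_family l.
have [V0 [CV0 [v v1]]] : exists V0 : groupType, C V0 /\ exists v : V0, v <> 1.
  by case: rootC.
exact: (reduced_detected (root_wreath rootC) CV0 v1 g CB redl (elimN eqP l_n0) sep).
Qed.
End Sufficiency.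

(** * Necessity *)

(** If [a] and [b] have the same order [N] and [a ^ m = b ^ (+-n)], then
    [gcd N m] divides both [m] and [n], so that [a ^ (gcd m n)] is a power of
    [a ^ m] and hence of [b ^ n]. *)
Lemma gcd_power (Y : groupType) (a b : Y) (N m n : nat) (e : bool) :
    has_order a N -> has_order b N -> (0 < m)%N ->
    a ^+ m = zexp b (if e then Posz n else - Posz n)%R ->
  exists j, a ^+ gcdn m n = zexp (b ^+ gcdn m n) j.
Proof.
move=> oa ob m_gt0 ab; have [N_gt0 aN _] := oa.
have gN : (gcdn m N %| N)%N := dvdn_gcdr m N.
have g_gt0 : (0 < gcdn m N)%N by rewrite gcdn_gt0 m_gt0.
have g_n : (gcdn m N %| n)%N.
  have q_gt0 : (0 < N %/ gcdn m N)%N by rewrite divn_gt0 // dvdn_leq.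
  rewrite -(dvdn_pmul2r q_gt0) mulnC divnK //; apply: (order_dvd ob).
  have : a ^+ (m * (N %/ gcdn m N)) = 1.
    rewrite -{1}(divnK (dvdn_gcdl m N)) -mulnA (mulnC (gcdn m N)) divnK //.
    by rewrite mulnC expgnA aN expg1n.
  rewrite !expgnA ab -zexp_nat -zexpM => bq; rewrite -expgnA -zexp_nat.
  move: bq; case: (e) => [bq|/eqP bq]; first by rewrite -bq PoszM.
  by move: bq; rewrite GRing.mulNr zexpN invg_eq1 PoszM => /eqP.
case: (egcdnP N m_gt0) => u v def _.
have gg : (gcdn m N %| gcdn m n)%N by rewrite dvdn_gcd dvdn_gcdl.
have ag : a ^+ gcdn m N = a ^+ (u * m).
  by rewrite def expgnDr mulnC expgnA aN expg1n mul1g.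
exists (Posz (n %/ gcdn m n) * (if e then 1 else -1) * Posz u * Posz (gcdn m n %/ gcdn m N))%R.
rewrite -{1}(divnK gg) mulnC expgnA ag (mulnC u) expgnA ab -!zexp_nat -!zexpM.
congr zexp; have := divnK (dvdn_gcdr m n) => /(congr1 Posz); rewrite PoszM => <-.
case: (e); lia.
Qed.

Section Necessity.
Variable C : group_class.
Hypothesis periodicC : forall X : groupType, C X -> periodic X.
Variables (G : groupType) (H K : groupClosed G).
Variable phi : {multiplicative subg H -> subg K}.
Local Notation hnn := (hnn phi).
Local Notation inc := (hnn_incl phi : {multiplicative G -> hnn}).
Local Notation t := (hnn_t phi).
Variables (h k : G) (hk : cyclic_hnn phi h k).
Hypotheses (h_central : central h) (k_central : central k).
Hypothesis proper : forall e, exists x, x \notin assoc_sub H K e.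
Hypothesis residualC : residually C hnn.

Lemma order_class (X : groupType) (x : X) : C X -> exists N, has_order x N.
Proof. by move=> CX; have [N N_gt0 xN] := periodicC CX x; exact: order_exists N_gt0 xN. Qed.

Lemma order_coprime (X : groupType) (x : X) N q :
  C X -> has_order x N -> primes_of' C q -> coprime q N.
Proof.
move=> CX ox [q_pr nCq]; rewrite prime_coprime //; apply/negP => qN.
exact/nCq/(prime_order_mem CX ox).
Qed.

(** By [britton_commute] a conjugate of [x] by the stable letter or its inverse
    fails to commute with some element of [G], and some [C]-quotient sees this. *)
Lemma noncommuting_quotient e x : x \notin assoc_sub H K e ->
  exists (Y : groupType) (f : {multiplicative hnn -> Y}) (y : G),
    C Y /\ ~ commute (f (inc x ^ sgn (~~ e) t)) (f (inc y)).
Proof.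
move=> x_out; have [y y_out] := proper (~~ e).
have nc := britton_commute hk x_out y_out.
have w1 : [~ inc x ^ sgn (~~ e) t, inc y] <> 1 by move/eqP/commgP.
have [Y [f [CY _ fw]]] := residualC w1; exists Y, f, y; split=> // com.
by apply: fw; rewrite homR; apply/eqP/commgP.
Qed.

Lemma conj_assoc e x : x \in assoc_sub H K e ->
  exists2 z, z \in assoc_sub H K (~~ e) & inc x ^ sgn (~~ e) t = inc z.
Proof.
case: e => /= [/(memK hk)|/(memH hk)] [a ->].
  by exists (zexp h a); [exact: zexp_memH hk a|exact: conj_tV_zexp hk a].
by exists (zexp k a); [exact: zexp_memK hk a|exact: conj_t_zexp hk a].
Qed.

(** In a [C]-group [x] is a power of [x ^+ q], while the conjugate of [x ^+ q] by
    the stable letter is central in [G]. *)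
Lemma assoc_isolated e : isolated (primes_of' C) (assoc_sub H K e).
Proof.
move=> x q Pq xq; apply: contrapT => /negP x_out.
have [Y [f [y [CY nc]]]] := noncommuting_quotient x_out; apply: nc.
have [z zA xqz] := conj_assoc xq.
set s := f _; have [N oN] := order_class s CY; have [_ sN _] := oN.
have gc := cyclic_subgroup_set (s ^+ q).
have [||a _ <-] := sg_coprime gc (order_coprime CY oN Pq) _ _ (x := s).
- by exists 1%R; rewrite ?zexp1.
- by rewrite sN; exact: sg1 gc.
apply/commute_sym/commute_zexp/commute_sym.
rewrite /s -homX -conjXg -homX xqz.
exact/gmulf_commute/gmulf_commute/(assoc_central hk h_central k_central zA).
Qed.

Lemma same_index_of_residual :
  (cosets H [predI H & K] #= cosets K [predI H & K])%card.
Proof.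
have [free|[m [n [m_gt0 n_gt0 mP nP]]]] := intersection_cases hk.
  have freeH a : zexp h a \in K -> a = 0%R.
    move=> /(memK hk)[b hb]; apply: (proj1 (free a (- b)%R _)).
    by rewrite /zexp2 zexpN hb mulgV.
  have freeK b : zexp k b \in H -> b = 0%R.
    move=> /(memH hk)[a kb]; apply: (proj2 (free (- a)%R b _)).
    by rewrite /zexp2 zexpN kb mulVg.
  have cH := cosets_card_infinite (D := [predI H & K]) (fun y => erefl) (memH hk) freeH.
  have cK := cosets_card_infinite (D := [predI H & K]) (fun y => andbC _ _) (memK hk) freeK.
  exact: card_eq_trans cH (card_esym cK).
have cH := cosets_card (D := [predI H & K]) m_gt0 (fun y => erefl) (memH hk) mP.
have cK := cosets_card (D := [predI H & K]) n_gt0 (fun y => andbC _ _) (memK hk) nP.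
suff eq_mn : m = n by rewrite eq_mn in cH; exact: card_eq_trans cH (card_esym cK).
have [e hm] := related_generators hk mP m_gt0 nP.
set g := gcdn m n.
have orders (Y : groupType) (f : {multiplicative hnn -> Y}) : C Y -> exists N,
    has_order (f (inc h)) N /\ has_order (f (inc k)) N.
  move=> CY; have [N oN] := order_class (f (inc h)) CY; exists N; split=> //.
  have kt : f (inc k) = f (inc h) ^ f t.
    by have := conj_t_zexp hk 1%R; rewrite !zexp1 => <-; rewrite /conjg !gmulfM homV.
  have [N_gt0 hN minN] := oN; split=> // [|i i_gt0].
    by rewrite kt -conjXg hN conj1g.
  by rewrite kt -conjXg => /eqP; rewrite conjg_eq1 => /eqP; exact: minN.
have hk_f (Y : groupType) (f : {multiplicative hnn -> Y}) :
    f (inc h) ^+ m = zexp (f (inc k)) (if e then Posz n else - Posz n)%R.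
  by rewrite -!homX hm !homZ.
have m_g : (m %| g)%N.
  have [//|/negP ndvd] := boolP (m %| g)%N.
  have x_out : h ^+ g \notin assoc_sub H K true.
    by apply/negP => /(mP (Posz g)).
  have [Y [f [y [CY nc]]]] := noncommuting_quotient x_out; exfalso; apply: nc.
  have [N [oh ok]] := orders _ f CY.
  have [j hj] := gcd_power oh ok m_gt0 (hk_f _ f).
  have -> : f (inc (h ^+ g) ^ t^-1) = f (inc (zexp h (Posz g * j)%R)).
    rewrite -(conj_tV_zexp hk) /conjg !gmulfM; congr (_ * (_ * _)).
    by rewrite !homX hj zexpM !homZ zexp_nat.
  exact/gmulf_commute/gmulf_commute/(sg_zexp _ (center_subgroup G) h_central).
have n_g : (n %| g)%N.
  have [//|/negP ndvd] := boolP (n %| g)%N.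
  have x_out : k ^+ g \notin assoc_sub H K false.
    by apply/negP => /(nP (Posz g)).
  have [Y [f [y [CY nc]]]] := noncommuting_quotient x_out; exfalso; apply: nc.
  have [N [oh ok]] := orders _ f CY.
  have kh_f : f (inc k) ^+ n = zexp (f (inc h)) (if e then Posz m else - Posz m)%R.
    have := hk_f _ f; case: (e) => hm_f; first exact/esym.
    by rewrite zexpN zexp_nat hm_f zexpN invgK.
  have [j hj] := gcd_power ok oh n_gt0 kh_f; rewrite gcdnC in hj.
  have -> : f (inc (k ^+ g) ^ t) = f (inc (zexp k (Posz g * j)%R)).
    rewrite -(conj_t_zexp hk) /conjg !gmulfM; congr (_ * (_ * _)).
    by rewrite !homX hj zexpM !homZ zexp_nat.
  exact/gmulf_commute/gmulf_commute/(sg_zexp _ (center_subgroup G) k_central).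
have gm : (g %| m)%N := dvdn_gcdl m n; have gn : (g %| n)%N := dvdn_gcdr m n.
have -> : m = g by apply/eqP; rewrite eqn_dvd m_g gm.
by apply/eqP; rewrite eqn_dvd n_g gn.
Qed.

(** If [h ^+ m = k ^- m], then [t] inverts [h ^+ m]; were all elements of
    [C]-groups of odd order, [h ^+ m] would vanish in every [C]-quotient. *)
Lemma central_or_two :
  primes_of C 2 \/ (forall x, x \in [predI H & K] -> central (inc x)).
Proof.
have [|n2] := pselect (primes_of C 2); [by left|right => x].
rewrite inE => /andP[/(memH hk)[a ->] aK].
have com_t : commute (inc (zexp h a)) t.
  have [free|[m [n [m_gt0 n_gt0 mP nP]]]] := intersection_cases hk.
    have /(memK hk)[b hb] := aK.
    have [|-> _] := free a (- b)%R; first by rewrite /zexp2 zexpN hb mulgV.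
    by rewrite zexp0 hom1 /commute mul1g mulg1.
  have /mP/divz_multiple[j ->] := aK.
  have eq_mn : m = n.
    apply/card_eq_II.
    have cH := cosets_card (D := [predI H & K]) m_gt0 (fun y => erefl) (memH hk) mP.
    have cK := cosets_card (D := [predI H & K]) n_gt0 (fun y => andbC _ _) (memK hk) nP.
    by apply: card_eq_trans (card_esym cH) _; apply: card_eq_trans same_index_of_residual cK.
  have [e hm] := related_generators hk mP m_gt0 nP.
  have conj_hm : inc (h ^+ m) ^ t = inc (zexp (h ^+ m) (if e then 1 else -1)%R).
    have := conj_t_zexp hk (Posz m); rewrite zexp_nat => ->; congr (inc _).
    rewrite hm -zexpM -eq_mn; congr zexp; case: (e); lia.
  rewrite zexpM homZ; apply: commute_sym; apply: commute_zexp; apply: commute_sym.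
  case: e hm conj_hm => hm conj_hm.
    by rewrite /commute [LHS]conjgC conj_hm.
  (* If all orders are odd, [f t] is a power of its square, which commutes with
     [u]. So [u] equals its inverse and, its order being odd, is trivial. *)
  have hm1 : inc (h ^+ m) <> 1.
    rewrite -(hom1 inc) => /(hnn_incl_inj hk) hm1.
    by have := h_inf hk (a := Posz m) hm1; lia.
  have [Y [f [CY _ fh]]] := residualC hm1; exfalso; apply: fh.
  set u := f _; have ut : u ^ f t = u^-1.
    rewrite /u -homV; have := congr1 f conj_hm; rewrite zexpN zexp1.
    by rewrite /conjg !gmulfM !homV.
  have P2 : primes_of' C 2 by split.
  have odd_power (v : Y) (A : set Y) : subgroup_set A -> A (v ^+ 2) -> A v.
    move=> gA Av2; have [N oN] := order_class v CY; have [_ vN _] := oN.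
    apply: (sg_coprime gA (order_coprime CY oN P2) Av2).
    by rewrite vN; exact: sg1 gA.
  have com_tu : u ^ f t = u.
    pose A : set Y := [set v | u ^ v = u].
    have gA : subgroup_set A.
      split=> [|v w uv uw|v uv]; rewrite /A /= ?conjg1 // ?conjgM; first by rewrite uv.
      by rewrite -{1}uv conjgK.
    apply: (odd_power _ A gA); rewrite /A /= expg2 conjgM ut conjVg ut.
    exact: invgK.
  apply: (odd_power u [set 1]); first exact: trivial_subgroup.
  by rewrite /= expg2 -{2}com_tu ut mulgV.
elim/hnn_ind => [g| |y z cy cz|y cy].
- exact/gmulf_commute/(sg_zexp _ (center_subgroup G) h_central).
- exact: com_t.
- exact: commuteM.
- exact: commuteV.
Qed.
End Necessity.

(** * Generators of the associated subgroups *)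

Lemma infinite_cyclic_gen (G : groupType) (H : groupClosed G) : infinite_cyclic H ->
  exists h, infinite_order h /\ forall x, x \in H <-> exists a, x = zexp h a.
Proof.
move=> [[h hH] infH]; exists h.
have memH x : x \in H <-> exists a, x = zexp h a.
  split=> [/hH[n [->|->]]|[[n|n] ->]].
  - by exists (Posz n).
  - by exists (- Posz n)%R; rewrite zexpN.
  - by apply/hH; exists n; left.
  - by apply/hH; exists n.+1; right.
split=> // a ha; apply: contrapT => a0; apply: infH.
have a_gt0 : (0 < `|a|)%N by rewrite absz_gt0; exact/eqP.
apply: (@sub_finite_set _ _ [set h ^+ i | i in `I_`|a|]); last exact/finite_image/finite_II.
move=> x /= /memH[b ->]; have [i [q [lt_i ->]]] := int_euclid b a_gt0.
by exists i => //; rewrite GRing.mulrC zexp_mod // zexp_abs1.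
Qed.

Lemma cyclic_hnn_exists (G : groupType) (H K : groupClosed G)
    (phi : {multiplicative subg H -> subg K}) : bijective phi ->
  infinite_cyclic H -> exists h k, cyclic_hnn phi h k.
Proof.
move=> bij_phi /infinite_cyclic_gen[h [h_inf memH]].
have hH : h \in H by apply/memH; exists 1%R.
pose k := val (phi (Subg hH)); exists h, k.
have phiE (x : subg H) a : val x = zexp h a -> val (phi x) = zexp k a.
  move=> xa; have -> : x = zexp (Subg hH) a.
    by apply: val_inj; rewrite xa -[RHS]/(subg_incl H (zexp (Subg hH) a)) homZ.
  by rewrite homZ -[LHS]/(subg_incl K (zexp (phi (Subg hH)) a)) homZ.
have zH a : zexp h a \in H by apply/memH; exists a.
split=> // [x|a ka].
  split=> [xK|[a ->]]; last by rewrite -(phiE (Subg (zH a))) //; exact: valP.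
  have [psi phiK psiK] := bij_phi; have /memH[a pa] := valP (psi (Subg xK)).
  by exists a; rewrite -(phiE _ _ pa) psiK.
apply: h_inf; have := phiE (Subg (zH a)) a erefl; rewrite ka => phi1.
have : phi (Subg (zH a)) = phi 1 by apply: val_inj; rewrite phi1 hom1.
by move/(bij_inj bij_phi)/(congr1 val).
Qed.

Theorem theorem3p4 (C : group_class) (G : groupType) (H K : groupClosed G)
  (phi : {multiplicative subg H -> subg K})
  (rootC : root_class C)
  (periodicC : forall X : groupType, C X -> periodic X)
  (phi_iso : bijective phi)
  (H_proper : ~ (forall x : G, x \in H))
  (K_proper : ~ (forall x : G, x \in K))
  (H_cyclic : infinite_cyclic H)
  (K_cyclic : infinite_cyclic K)
  (H_central : forall x : G, x \in H -> central x)
  (K_central : forall x : G, x \in K -> central x)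
  (G_residual : residually (BN C) G)
  (G_hom : exists (X : groupType) (f : {multiplicative G -> X}),
     [/\ BN C X, surjective_map f & set_inj (set_mul H K) f]) :
  residually C (hnn phi) <->
  [/\ (cosets H [predI H & K] #= cosets K [predI H & K])%card,
      isolated (primes_of' C) H /\ isolated (primes_of' C) K
    & primes_of C 2 \/
      (forall x : G, x \in [predI H & K] -> central (hnn_incl phi x))].
Proof.
have [h [k hk]] := cyclic_hnn_exists phi_iso H_cyclic.
have ch : central h by apply: H_central; exact: (zexp_memH hk 1%R).
have ck : central k by apply: K_central; exact: (zexp_memK hk 1%R).
split=> [resC|[same [isoH isoK] two]].
  have proper e : exists x, x \notin assoc_sub H K e.
    by case: e; [have /existsNP[x /negP] := K_proper|have /existsNP[x /negP] := H_proper]; exists x.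
  split; first exact: (same_index_of_residual periodicC hk ch ck proper resC).
    split; first exact: (assoc_isolated periodicC hk ch ck proper resC (e := false)).
    exact: (assoc_isolated periodicC hk ch ck proper resC (e := true)).
  exact: (central_or_two periodicC hk ch ck proper resC).
have [X [sigma [BNX _ inj_sigma]]] := G_hom.
apply: (hnn_residually rootC periodicC hk ch ck BNX G_residual (sigma := sigma)) => //.
move=> a b z1; apply: inj_sigma; rewrite ?inE ?hom1 //.
  by exists (zexp h a), (zexp k b); rewrite (zexp_memH hk) (zexp_memK hk).
by exists 1, 1; rewrite !gpred1 mulg1.
Qed.
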